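(* For every initial condition $(s(0),v(0))\in\Omega$, the solution $(s(t),v(t))\in\Omega$ of the microscopic inviscid ACC model is defined for all $t\ge 0$ and satisfies $$s_i(t)\le \max(\lambda,s_i(0))+\mu^{-1}v_{\max}\quad\text{for all } t\ge 0 \text{ and } i=2,\dots,n.$$ Moreover, $\lim_{t\to+\infty}v_i(t)=v^*$ for all $i=1,\dots,n$, and $\lim_{t\to+\infty}V(s_i(t))=0$ for all $i=2,\dots,n$.
   Context: Notation: $\mathbb{R}_+=[0,+\infty)$. Let $n\ge 2$ be an integer and let $\mu>0$, $\lambda>L>0$, $v_{\max}>v^*>0$ be constants. Let $V\in C^2((L,+\infty);\mathbb{R}_+)$ satisfy: $\lim_{s\to L^+}V(s)=+\infty$; $V''(s)\ge 0$ for all $s>L$; $V(s)=0$ for all $s\ge\lambda$; $V'(s)<0$ for all $s\in(L,\lambda)$. Let $f\in C^1(\mathbb{R})$ be non-decreasing with $\max(x,0)\le f(x)$ for all $x\in\mathbb{R}$, and define $$g(x)=\frac{v_{\max}f(x)}{v^*(v_{\max}-v^* )}-\frac{x}{v^*},\quad x\in\mathbb{R}.$$ Define $k_1(s_2)=\mu+g(-V'(s_2))$, $k_i(s_i,s_{i+1})=\mu+g(V'(s_i)-V'(s_{i+1}))$ for $i=2,\dots,n-1$, and $k_n(s_n)=\mu+g(V'(s_n))$. The microscopic inviscid ACC model, with state $(s,v)$, $s=(s_2,\dots,s_n)\in\mathbb{R}^{n-1}$, $v=(v_1,\dots,v_n)\in\mathbb{R}^n$, is the ODE system $$\dot s_i=v_{i-1}-v_i,\quad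 i=2,\dots,n,$$ $$\dot v_1=-k_1(s_2)(v_1-v^* )-V'(s_2),$$ $$\dot v_i=-k_i(s_i,s_{i+1})(v_i-v^* )+V'(s_i)-V'(s_{i+1}),\quad i=2,\dots,n-1,$$ $$\dot v_n=-k_n(s_n)(v_n-v^* )+V'(s_n),$$ with state space $$\Omega=\Big\{(s_2,\dots,s_n,v_1,\dots,v_n)\in\mathbb{R}^{2n-1}:\ \min_{i=2,\dots,n}s_i>L,\ \max_{i=1,\dots,n}v_i\le v_{\max},\ \min_{i=1,\dots,n}v_i\ge 0\Big\}.$$ *)

(* Defs.v *)
From Stdlib Require Import Reals.
From Coquelicot Require Import Coquelicot.
Open Scope R_scope.

(* A vector (s_2, ..., s_n) or (v_1, ..., v_n) is a family [nat -> R] carrying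
   the indices of the model; entries outside the stated index range are
   irrelevant and are never constrained.  The potential [V] is a total function
   on [R] of which only the restriction to (L, +oo) is ever used. *)

Definition class_C1 (f : R -> R) : Prop :=
  forall x, ex_derive f x /\ continuous (Derive f) x.

(* [ex_derive_n V 2 x] alone would not do: it only says that the total function
   [Derive V] is differentiable at [x], not that [V] is. *)
Definition class_C2_above (L : R) (V : R -> R) : Prop :=
  forall x, L < x ->
    ex_derive V x /\ ex_derive_n V 2 x /\ continuous (Derive_n V 2) x.

Record ACC_potential (L lambda : R) (V : R -> R) : Prop := {
  potential_C2 : class_C2_above L V;
  potential_ge0 : forall x, L < x -> 0 <= V x;
  potential_lim : filterlim V (at_right L) (Rbar_locally p_infty);
  potential_convex : forall x, L < x -> 0 <= Derive_n V 2 x;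
  potential_eq0 : forall x, lambda <= x -> V x = 0;
  potential_decr : forall x, L < x < lambda -> Derive V x < 0 }.

Definition ACC_g (vmax vstar : R) (f : R -> R) (x : R) : R :=
  vmax * f x / (vstar * (vmax - vstar)) - x / vstar.

Section Model.

Variables (n : nat) (mu L vmax vstar : R) (V f : R -> R).

Definition ACC_k_first (s2 : R) : R := mu + ACC_g vmax vstar f (- Derive V s2).

Definition ACC_k_mid (si si1 : R) : R :=
  mu + ACC_g vmax vstar f (Derive V si - Derive V si1).

Definition ACC_k_last (sn : R) : R := mu + ACC_g vmax vstar f (Derive V sn).

Definition ACC_Omega (s v : nat -> R) : Prop :=
  (forall i, (2 <= i <= n)%nat -> L < s i) /\
  (forall i, (1 <= i <= n)%nat -> v i <= vmax) /\
  (forall i, (1 <= i <= n)%nat -> 0 <= v i).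

(* [J] is the time interval.  [D_in x x' J t] is differentiability relative to
   [J], hence one-sided at the end point 0.  The condition [L < s i t] keeps the
   trajectory where the right-hand side is defined; membership in [ACC_Omega] is
   not part of the notion of solution. *)
Record ACC_solution (J : R -> Prop) (s v : nat -> R -> R) : Prop := {
  ACC_domain : forall t i, J t -> (2 <= i <= n)%nat -> L < s i t;
  ACC_s : forall t i, J t -> (2 <= i <= n)%nat ->
    D_in (s i) (fun u => v (i - 1)%nat u - v i u) J t;
  ACC_v_first : forall t, J t ->
    D_in (v 1%nat)
      (fun u => - ACC_k_first (s 2%nat u) * (v 1%nat u - vstar)
                - Derive V (s 2%nat u)) J t;
  ACC_v_mid : forall t i, J t -> (2 <= i <= n - 1)%nat ->
    D_in (v i)
      (fun u => - ACC_k_mid (s i u) (s (i + 1)%nat u) * (v i u - vstar)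
                + Derive V (s i u) - Derive V (s (i + 1)%nat u)) J t;
  ACC_v_last : forall t, J t ->
    D_in (v n)
      (fun u => - ACC_k_last (s n u) * (v n u - vstar) + Derive V (s n u)) J t }.

Definition ACC_starts_at (s0 v0 : nat -> R) (s v : nat -> R -> R) : Prop :=
  (forall i, (2 <= i <= n)%nat -> s i 0 = s0 i) /\
  (forall i, (1 <= i <= n)%nat -> v i 0 = v0 i).

End Model.

(* Main.v *)
(** Put p_i = V'(s_i) for 2 <= i <= n and p_1 = p_(n+1) = 0; then all cars obey
    v_i' = - (mu + g (p_i - p_(i+1))) (v_i - v* ) + p_i - p_(i+1).  The lower bounds
    on f make g large enough for [0, vmax] to be invariant for each v_i, and
    the energy H = sum (v_i - v* )^2 / 2 + sum V(s_i) decreases at a rate at least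
    mu (v_i - v* )^2.  Choosing sigma > L with V(sigma) > H(0), truncate V' to
    [sigma, lambda] and the velocities to [0, vmax]: the field becomes bounded and
    globally Lipschitz, so that Picard iteration gives a global solution, whose
    energy forces s_i > sigma; hence the truncation is never active, and neither is
    it for any other solution, whence uniqueness.  Barbalat's argument applied to H
    gives v_i -> v*, applied to v_i it gives p_i - p_(i+1) -> 0, so p_i -> 0 by
    induction from p_1 = 0, and convexity gives V(s_i) <= - p_i (lambda - L). *)

Require Import Defs.
From Stdlib Require Import Reals Lra Lia.
From Coquelicot Require Import Coquelicot.
Open Scope R_scope.

(** * Monotonicity, barriers and limits *)

(** The field lives only where all spacings exceed [L], and V' is unbounded near [L], so no
    Lipschitz bound is available before the spacings are kept away from [L]. Solving a truncated
    system first avoids maximal solutions and a blow-up alternative: the a priori estimates are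
    proved on a curve that already exists for all times. Truncating the force alone is not enough,
    because the damping is a product of a function of the spacings and a velocity, hence not
    globally Lipschitz as long as velocities are unbounded. The truncations come off in a forced
    order. The velocity barrier works for any force whatsoever, whereas the energy balance needs the
    same unclamped velocity in the spacing and the velocity equations. The force truncation is
    compatible with energy because the truncated force is still a gradient: its primitive prolongs V
    below sigma by its tangent line, hence stays above V(sigma) there. In the last use of Barbalat's
    argument the damping is a perturbation tending to 0, so no second derivative of the velocities
    is taken. *)

Lemma is_derive_continuity_pt (f : R -> R) (x l : R) :
  is_derive f x l -> continuity_pt f x.
Proof.
  intros H. apply continuity_pt_filterlim.
  apply (ex_derive_continuous f x). now exists l.
Qed.

(** Derivatives are asked only inside the interval and continuity up to its ends, because a solution
    starting at time 0 has only a right derivative there. *)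
Lemma derive_le_increment (f g df dg : R -> R) (a b : R) :
  a <= b ->
  (forall t, a <= t <= b -> continuity_pt f t) ->
  (forall t, a <= t <= b -> continuity_pt g t) ->
  (forall t, a < t < b -> is_derive f t (df t)) ->
  (forall t, a < t < b -> is_derive g t (dg t)) ->
  (forall t, a < t < b -> df t <= dg t) ->
  f b - f a <= g b - g a.
Proof.
  intros Hab cf cg Df Dg Hd.
  (* [MVT_gen] may return an end point, where nothing is known of [dg - df]. *)
  pose (d := fun t => if Rlt_dec a t then
                        if Rlt_dec t b then dg t - df t else 0 else 0).
  destruct (MVT_gen (fun t => g t - f t) a b d) as [c [_ Hc]].
  - rewrite Rmin_left, Rmax_right by lra. intros x Hx. unfold d.
    destruct (Rlt_dec a x); [|lra]. destruct (Rlt_dec x b); [|lra].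
    apply (is_derive_minus g f); auto.
  - rewrite Rmin_left, Rmax_right by lra. intros x Hx.
    apply continuity_pt_minus; auto.
  - assert (0 <= d c).
    { unfold d. destruct (Rlt_dec a c); [|lra]. destruct (Rlt_dec c b); [|lra].
      specialize (Hd c). lra. }
    assert (0 <= d c * (b - a)) by (apply Rmult_le_pos; lra). lra.
Qed.

Lemma derive_abs_le_increment (f g df dg : R -> R) (a b : R) :
  a <= b ->
  (forall t, a <= t <= b -> continuity_pt f t) ->
  (forall t, a <= t <= b -> continuity_pt g t) ->
  (forall t, a < t < b -> is_derive f t (df t)) ->
  (forall t, a < t < b -> is_derive g t (dg t)) ->
  (forall t, a < t < b -> Rabs (df t) <= dg t) ->
  Rabs (f b - f a) <= g b - g a.
Proof.
  intros Hab cf cg Df Dg Hd. apply Rabs_le. split.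
  - enough (- f b - - f a <= g b - g a) by lra.
    apply (derive_le_increment (fun t => - f t) g (fun t => - df t) dg); auto.
    + intros t Ht. apply continuity_pt_opp; auto.
    + intros t Ht. apply (is_derive_opp f); auto.
    + intros t Ht. specialize (Hd t Ht). apply Rabs_le_between in Hd. lra.
  - apply (derive_le_increment f g df dg); auto.
    intros t Ht. specialize (Hd t Ht). apply Rabs_le_between in Hd. lra.
Qed.

Lemma bounded_derive_lipschitz (f df : R -> R) (K a b : R) :
  (forall t, Rmin a b <= t <= Rmax a b -> is_derive f t (df t)) ->
  (forall t, Rmin a b <= t <= Rmax a b -> Rabs (df t) <= K) ->
  Rabs (f b - f a) <= K * Rabs (b - a).
Proof.
  intros Df Hd. destruct (MVT_gen f a b df) as [c [Hc ->]].
  - intros x Hx. apply Df; lra.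
  - intros x Hx. eapply is_derive_continuity_pt, Df; lra.
  - rewrite Rabs_mult. apply Rmult_le_compat_r; [apply Rabs_pos | now apply Hd].
Qed.

Lemma lipschitz_continuity_pt (f : R -> R) (K x : R) :
  (forall y, Rabs (f y - f x) <= K * Rabs (y - x)) -> continuity_pt f x.
Proof.
  intros Hf eps Heps.
  assert (HK : 0 < Rabs K + 1) by (pose proof (Rabs_pos K); lra).
  exists (eps / (Rabs K + 1)). split; [now apply Rdiv_lt_0_compat|].
  intros y [_ Hy]. simpl in *. unfold Rdist in *.
  apply Rle_lt_trans with ((Rabs K + 1) * Rabs (y - x)).
  - eapply Rle_trans; [apply Hf|]. apply Rmult_le_compat_r; [apply Rabs_pos|].
    pose proof (Rle_abs K). lra.
  - apply (Rmult_lt_compat_l (Rabs K + 1)) in Hy; [|lra].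
    replace ((Rabs K + 1) * (eps / (Rabs K + 1))) with eps in Hy by (field; lra).
    exact Hy.
Qed.

Lemma C1_lipschitz_segment (f df : R -> R) (a b : R) :
  a <= b ->
  (forall x, a <= x <= b -> is_derive f x (df x)) ->
  (forall x, a <= x <= b -> continuity_pt df x) ->
  exists K, 0 < K /\ forall x y, a <= x <= b -> a <= y <= b ->
    Rabs (f x - f y) <= K * Rabs (x - y).
Proof.
  intros Hab Df cdf.
  destruct (continuity_ab_maj (fun x => Rabs (df x)) a b Hab) as [M [HM _]].
  { intros c Hc. apply (continuity_pt_comp df Rabs); [now apply cdf|].
    apply Rcontinuity_abs. }
  exists (Rabs (df M) + 1). split; [pose proof (Rabs_pos (df M)); lra|].
  intros x y Hx Hy.
  assert (Hxy : forall t, Rmin y x <= t <= Rmax y x -> a <= t <= b).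
  { intros t Ht. unfold Rmin, Rmax in Ht. destruct (Rle_dec y x); lra. }
  apply (bounded_derive_lipschitz f df); auto.
  intros t Ht. specialize (HM t (Hxy t Ht)). lra.
Qed.

(** [r] is the supremum of the times with [f t <= c]. By continuity, [c < f r] would make an earlier
    time an upper bound, and [f r < c] would produce such times after [r]. *)
Lemma last_crossing (f : R -> R) (a b c : R) :
  a <= b -> (forall t, a <= t <= b -> continuity_pt f t) ->
  f a <= c -> c < f b ->
  exists r, a <= r < b /\ f r = c /\ forall t, r < t <= b -> c < f t.
Proof.
  intros Hab cf Ha Hb.
  destruct (completeness (fun t => a <= t <= b /\ f t <= c)) as [r [Hub Hlub]].
  { exists b. intros t [Ht _]. lra. }
  { exists a. lra. }
  assert (Har : a <= r) by (apply Hub; lra).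
  assert (Hrb : r <= b) by (apply Hlub; intros t [Ht _]; lra).
  assert (Hgt : forall t, r < t <= b -> c < f t).
  { intros t Ht. destruct (Rlt_le_dec c (f t)) as [H|H]; auto.
    assert (t <= r) by (apply Hub; lra). lra. }
  assert (Hle : f r <= c).
  { apply Rnot_lt_le. intros Hlt.
    destruct (cf r (conj Har Hrb) (f r - c)) as [d [Hd Hc]]; [lra|].
    assert (r <= r - d / 2); [|lra]. apply Hlub. intros t [Ht Htc].
    assert (t <= r) by (apply Hub; lra).
    apply Rnot_lt_le. intros Htd.
    assert (t <> r) by (intros ->; lra).
    specialize (Hc t). simpl in Hc. unfold Rdist, D_x, no_cond in Hc.
    assert (Rabs (f t - f r) < f r - c).
    { apply Hc. split; [split; auto|]. apply Rabs_def1; lra. }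
    apply Rabs_lt_between in H1. lra. }
  assert (r < b) by (destruct (Req_dec r b) as [->|]; lra).
  assert (Hge : c <= f r).
  { apply Rnot_lt_le. intros Hlt.
    destruct (cf r (conj Har Hrb) (c - f r)) as [d [Hd Hc]]; [lra|].
    pose (t := Rmin b (r + d / 2)).
    assert (r < t <= b /\ t <= r + d / 2).
    { unfold t, Rmin. destruct (Rle_dec b (r + d / 2)); lra. }
    assert (c < f t) by (apply Hgt; lra).
    specialize (Hc t). simpl in Hc. unfold Rdist, D_x, no_cond in Hc.
    assert (Rabs (f t - f r) < c - f r).
    { apply Hc. split; [split; auto; lra|]. apply Rabs_def1; lra. }
    apply Rabs_lt_between in H2. lra. }
  exists r. repeat split; auto; lra.
Qed.

(** After the last time at level [c] the derivative is nonpositive, so [f] cannot end above [c]. The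
    sign is required only strictly above the level. *)
Lemma barrier (f df : R -> R) (a b c : R) :
  a <= b -> (forall t, a <= t <= b -> continuity_pt f t) ->
  (forall t, a < t < b -> is_derive f t (df t)) ->
  (forall t, a < t < b -> c < f t -> df t <= 0) ->
  f a <= c -> f b <= c.
Proof.
  intros Hab cf Df Hd Ha. apply Rnot_lt_le. intros Hb.
  destruct (last_crossing f a b c) as [r [Hr [Hfr Hgt]]]; auto.
  enough (f b - f r <= c - c) by lra.
  apply (derive_le_increment f (fun _ => c) df (fun _ => 0)).
  - lra.
  - intros; apply cf; lra.
  - intros; apply continuity_pt_const; intros ? ?; auto.
  - intros; apply Df; lra.
  - intros; apply (is_derive_const c).
  - intros t Ht. apply Hd; [lra|]. apply Hgt; lra.
Qed.

Lemma is_lim_p_infty (f : R -> R) (l : R) :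
  is_lim f p_infty l <->
  forall eps, 0 < eps -> exists M, forall t, M < t -> Rabs (f t - l) < eps.
Proof.
  rewrite <- is_lim_spec. split.
  - intros H eps Heps. exact (H (mkposreal eps Heps)).
  - intros H eps. exact (H eps (cond_pos eps)).
Qed.

Lemma nonincreasing_is_lim (f : R -> R) (m : R) :
  (forall x y, 0 <= x <= y -> f y <= f x) -> (forall t, 0 <= t -> m <= f t) ->
  exists l : R, is_lim f p_infty l.
Proof.
  intros Hf Hm.
  destruct (completeness (fun y => exists t, 0 <= t /\ y = - f t)) as [l [Hub Hlub]].
  { exists (- m). intros y [t [Ht ->]]. specialize (Hm t Ht). lra. }
  { exists (- f 0), 0. lra. }
  exists (- l). apply is_lim_p_infty. intros eps Heps.
  assert (exists t, 0 <= t /\ f t < - l + eps) as [M [HM0 HM]].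
  { apply Classical_Prop.NNPP. intros Hn.
    assert (l <= l - eps); [|lra]. apply Hlub. intros y [t [Ht ->]].
    apply Rnot_lt_le. intros Hlt. apply Hn. exists t. lra. }
  exists M. intros t Ht.
  assert (f t <= f M) by (apply Hf; lra).
  assert (- f t <= l) by (apply Hub; exists t; split; auto; lra).
  apply Rabs_def1; lra.
Qed.

(* If [q] exceeded [eps] at some late time, its Lipschitz bound would keep it
   large for a fixed duration, during which [f] would grow by a fixed amount. *)
Lemma barbalat (f df q a : R -> R) (K l : R) :
  0 < K ->
  (forall t, 0 < t -> is_derive f t (df t)) ->
  (forall t, 0 < t -> q t + a t <= df t) ->
  (forall t u, 0 < t -> 0 < u -> Rabs (q t - q u) <= K * Rabs (t - u)) ->
  is_lim f p_infty l -> is_lim a p_infty 0 ->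
  forall eps, 0 < eps -> exists M, forall t, M < t -> q t < eps.
Proof.
  intros HK Df Hdf Hq Hf Ha eps Heps.
  rewrite is_lim_p_infty in Hf, Ha.
  (* During a time [d] the function [q] loses at most [eps / 4] and [a] costs at most another
     [eps / 4], so [f] grows by at least [eps / 2 * d]. Two values within [eps * d / 4] of [l]
     cannot differ by that much. *)
  pose (d := eps / (4 * K)).
  assert (Hd : 0 < d) by (apply Rdiv_lt_0_compat; lra).
  assert (HKd : K * d = eps / 4) by (unfold d; field; lra).
  assert (Hed : 0 < eps * d) by (apply Rmult_lt_0_compat; lra).
  destruct (Hf (eps * d / 4)) as [M1 HM1]; [lra|].
  destruct (Ha (eps / 4)) as [M2 HM2]; [lra|].
  exists (Rmax 0 (Rmax M1 M2)). intros t Ht.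
  assert (0 < t /\ M1 < t /\ M2 < t) as [Ht0 [Ht1 Ht2]].
  { pose proof (Rmax_l 0 (Rmax M1 M2)). pose proof (Rmax_r 0 (Rmax M1 M2)).
    pose proof (Rmax_l M1 M2). pose proof (Rmax_r M1 M2). lra. }
  apply Rnot_le_lt. intros Hqt.
  assert (H1 := HM1 t Ht1). assert (H2 := HM1 (t + d) ltac:(lra)).
  apply Rabs_def2 in H1. apply Rabs_def2 in H2.
  enough (eps / 2 * (t + d) - eps / 2 * t <= f (t + d) - f t) by lra.
  apply (derive_le_increment (fun u => eps / 2 * u) f (fun _ => eps / 2) df).
  - lra.
  - intros u _. apply (is_derive_continuity_pt _ _ (eps / 2)).
    auto_derive; auto; ring.
  - intros u Hu. eapply is_derive_continuity_pt, Df. lra.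
  - intros u _. auto_derive; auto; ring.
  - intros u Hu. apply Df. lra.
  - intros u Hu. eapply Rle_trans; [|apply Hdf; lra].
    assert (H3 := HM2 u ltac:(lra)). apply Rabs_def2 in H3.
    assert (H4 : Rabs (q u - q t) <= eps / 4).
    { eapply Rle_trans; [apply Hq; lra|]. rewrite <- HKd.
      apply Rmult_le_compat_l; [lra|]. apply Rabs_le. lra. }
    apply Rabs_le_between in H4. lra.
Qed.

(** * Flows of bounded Lipschitz fields *)

Section GlobalFlow.

(** The sup norm over the coordinates in [A] is represented by its upper bounds [d], which avoids a
    function space. With [d = 0] the Lipschitz hypothesis also says that [F k] depends only on the
    coordinates in [A]. *)
Variables (I : Type) (A : I -> Prop) (F : I -> (I -> R) -> R) (K B : R).
Hypothesis K_pos : 0 < K.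
Hypothesis B_pos : 0 < B.
Hypothesis F_lipschitz : forall x y d,
  (forall j, A j -> Rabs (x j - y j) <= d) ->
  forall k, A k -> Rabs (F k x - F k y) <= K * d.
Hypothesis F_bounded : forall k x, A k -> Rabs (F k x) <= B.

(* Measured with the weight [exp (2 K t)], an integration of [F] is a
   contraction of ratio 1/2. *)
Lemma picard_contraction (x y X Y : I -> R -> R) (t d : R) (k : I) :
  0 <= t -> 0 <= d -> A k -> X k 0 = Y k 0 ->
  (forall u, 0 <= u <= t -> continuity_pt (X k) u) ->
  (forall u, 0 <= u <= t -> continuity_pt (Y k) u) ->
  (forall u, 0 < u < t -> is_derive (X k) u (F k (fun j => x j u))) ->
  (forall u, 0 < u < t -> is_derive (Y k) u (F k (fun j => y j u))) ->
  (forall u j, 0 < u < t -> A j ->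
     Rabs (x j u - y j u) <= d * exp (2 * K * u)) ->
  Rabs (X k t - Y k t) <= d / 2 * exp (2 * K * t).
Proof.
  intros Ht Hd Hk H0 cX cY DX DY Hxy.
  pose (w := fun u => d / 2 * exp (2 * K * u)).
  assert (Dw : forall u, is_derive w u (K * (d * exp (2 * K * u)))).
  { intros u. unfold w. auto_derive; auto; field. }
  assert (H : Rabs ((X k t - Y k t) - (X k 0 - Y k 0)) <= w t - w 0).
  { apply (derive_abs_le_increment (fun u => X k u - Y k u) w
      (fun u => F k (fun j => x j u) - F k (fun j => y j u))
      (fun u => K * (d * exp (2 * K * u)))); auto.
    - intros u Hu. apply continuity_pt_minus; auto.
    - intros u Hu. eapply is_derive_continuity_pt, Dw.
    - intros u Hu. apply (is_derive_minus (X k) (Y k)); auto. }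
  unfold w in H at 2. rewrite Rmult_0_r, exp_0 in H.
  replace (X k t - Y k t - (X k 0 - Y k 0)) with (X k t - Y k t) in H by lra.
  unfold w in H. lra.
Qed.

Lemma half_pow_le (c : R) (m : nat) : 0 <= c -> 0 <= c * (/ 2) ^ m <= c.
Proof.
  intros Hc. assert (0 < (/ 2) ^ m) by (apply pow_lt; lra).
  assert ((/ 2) ^ m <= 1).
  { rewrite <- (pow1 m). apply pow_incr. lra. }
  split; nra.
Qed.

Lemma half_pow_lim (c a : R) :
  (forall m : nat, a <= c * (/ 2) ^ m) -> a <= 0.
Proof.
  intros H.
  assert (Rbar_le a 0) as Ha; [|exact Ha].
  apply (is_lim_seq_le (fun _ => a) (fun m => c * (/ 2) ^ m)); auto.
  - apply is_lim_seq_const.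
  - replace 0 with (c * 0) by ring.
    apply (is_lim_seq_scal_l (fun m => (/ 2) ^ m) c 0), is_lim_seq_geom.
    rewrite Rabs_pos_eq; lra.
Qed.

(** Boundedness of [F] gives a first estimate [2 * B * T] of the distance, and each use of
    [picard_contraction] halves it. *)
Lemma flow_unique (x y : I -> R -> R) (T : R) :
  (forall k, A k -> x k 0 = y k 0) ->
  (forall k u, A k -> 0 <= u < T -> continuity_pt (x k) u) ->
  (forall k u, A k -> 0 <= u < T -> continuity_pt (y k) u) ->
  (forall k u, A k -> 0 < u < T -> is_derive (x k) u (F k (fun j => x j u))) ->
  (forall k u, A k -> 0 < u < T -> is_derive (y k) u (F k (fun j => y j u))) ->
  forall k t, A k -> 0 <= t < T -> x k t = y k t.
Proof.
  intros H0 cx cy Dx Dy.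
  assert (Hm : forall m k t, A k -> 0 <= t < T ->
    Rabs (x k t - y k t) <= 2 * B * T * (/ 2) ^ m * exp (2 * K * t)).
  { induction m as [|m IH]; intros k t Hk Ht.
    - rewrite pow_O, Rmult_1_r.
      apply Rle_trans with (2 * B * t - 2 * B * 0).
      + replace (x k t - y k t) with ((x k t - y k t) - (x k 0 - y k 0))
          by (rewrite H0; [ring|auto]).
        apply (derive_abs_le_increment (fun u => x k u - y k u)
          (fun u => 2 * B * u)
          (fun u => F k (fun j => x j u) - F k (fun j => y j u))
          (fun _ => 2 * B)); try lra.
        * intros u Hu. apply continuity_pt_minus; [apply cx | apply cy]; auto; lra.
        * intros u _. apply (is_derive_continuity_pt _ _ (2 * B)).
          auto_derive; auto; ring.
        * intros u Hu. apply (is_derive_minus (x k) (y k));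
            [apply Dx | apply Dy]; auto; lra.
        * intros u _. auto_derive; auto; ring.
        * intros u _. eapply Rle_trans; [apply Rabs_triang|]. rewrite Rabs_Ropp.
          pose proof (F_bounded k (fun j => x j u) Hk).
          pose proof (F_bounded k (fun j => y j u) Hk). lra.
      + assert (1 <= exp (2 * K * t)).
        { pose proof (exp_ineq1_le (2 * K * t)). nra. }
        assert (B * t <= B * T) by nra. assert (0 <= B * T) by nra. nra.
    - simpl pow.
      replace (2 * B * T * (/ 2 * (/ 2) ^ m)) with (2 * B * T * (/ 2) ^ m / 2)
        by field.
      apply (picard_contraction x y); auto; try lra.
      + apply half_pow_le. nra.
      + intros u Hu. apply cx; auto; lra.
      + intros u Hu. apply cy; auto; lra.
      + intros u Hu. apply Dx; auto; lra.
      + intros u Hu. apply Dy; auto; lra.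
      + intros u j Hu Hj. apply IH; auto; lra. }
  intros k t Hk Ht. apply Rminus_diag_uniq.
  apply Rabs_eq_0, Rle_antisym; [|apply Rabs_pos].
  apply (half_pow_lim (2 * B * T * exp (2 * K * t))).
  intros m. specialize (Hm m k t Hk Ht). lra.
Qed.

(** Being [B]-Lipschitz in time is the only regularity that the iteration carries: it makes the
    integrand continuous, and both [picard_map] and pointwise limits preserve it. *)
Lemma field_along_lipschitz (x : I -> R -> R) :
  (forall j t u, A j -> Rabs (x j t - x j u) <= B * Rabs (t - u)) ->
  forall k u, A k -> continuous (fun t => F k (fun j => x j t)) u.
Proof.
  intros Hx k u Hk. apply continuity_pt_filterlim.
  apply (lipschitz_continuity_pt _ (K * B)). intros t.
  rewrite Rmult_assoc. apply F_lipschitz; auto.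
Qed.

Definition picard_map (x0 : I -> R) (x : I -> R -> R) (k : I) (t : R) : R :=
  x0 k + RInt (fun u => F k (fun j => x j u)) 0 t.

Lemma picard_map_0 (x0 : I -> R) (x : I -> R -> R) (k : I) :
  picard_map x0 x k 0 = x0 k.
Proof.
  unfold picard_map. rewrite RInt_point. apply Rplus_0_r.
Qed.

Lemma picard_map_derive (x0 : I -> R) (x : I -> R -> R) :
  (forall j t u, A j -> Rabs (x j t - x j u) <= B * Rabs (t - u)) ->
  forall k t, A k ->
    is_derive (picard_map x0 x k) t (F k (fun j => x j t)).
Proof.
  intros Hx k t Hk. unfold picard_map.
  rewrite <- (Rplus_0_l (F k (fun j => x j t))).
  apply (is_derive_plus (fun _ => x0 k)
    (fun t => RInt (fun u => F k (fun j => x j u)) 0 t)).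
  - apply (is_derive_const (x0 k)).
  - apply (is_derive_RInt (fun u => F k (fun j => x j u)) _ 0).
    + apply filter_forall. intros v. apply (RInt_correct (V := R_CompleteNormedModule)).
      apply (ex_RInt_continuous (V := R_CompleteNormedModule)). intros z _. now apply field_along_lipschitz.
    + now apply field_along_lipschitz.
Qed.

Lemma picard_map_lipschitz (x0 : I -> R) (x : I -> R -> R) :
  (forall j t u, A j -> Rabs (x j t - x j u) <= B * Rabs (t - u)) ->
  forall k t u, A k ->
    Rabs (picard_map x0 x k t - picard_map x0 x k u) <= B * Rabs (t - u).
Proof.
  intros Hx k t u Hk.
  apply (bounded_derive_lipschitz _ (fun v => F k (fun j => x j v))).
  - intros v _. now apply picard_map_derive.
  - intros v _. now apply F_bounded.
Qed.

Fixpoint picard_iter (x0 : I -> R) (m : nat) : I -> R -> R :=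
  match m with
  | O => fun k _ => x0 k
  | S m => picard_map x0 (picard_iter x0 m)
  end.

Lemma picard_iter_lipschitz (x0 : I -> R) (m : nat) (k : I) (t u : R) :
  A k -> Rabs (picard_iter x0 m k t - picard_iter x0 m k u) <= B * Rabs (t - u).
Proof.
  revert k t u. induction m as [|m IH]; intros k t u Hk; simpl.
  - rewrite Rminus_diag, Rabs_R0. apply Rmult_le_pos; [lra | apply Rabs_pos].
  - now apply picard_map_lipschitz.
Qed.

Lemma picard_map_contraction (x0 : I -> R) (x y : I -> R -> R) (d : R) :
  0 <= d ->
  (forall j t u, A j -> Rabs (x j t - x j u) <= B * Rabs (t - u)) ->
  (forall j t u, A j -> Rabs (y j t - y j u) <= B * Rabs (t - u)) ->
  (forall j t, A j -> 0 <= t -> Rabs (x j t - y j t) <= d * exp (2 * K * t)) ->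
  forall k t, A k -> 0 <= t ->
    Rabs (picard_map x0 x k t - picard_map x0 y k t) <= d / 2 * exp (2 * K * t).
Proof.
  intros Hd Hx Hy Hxy k t Hk Ht.
  apply (picard_contraction x y); auto.
  - now rewrite !picard_map_0.
  - intros u _. eapply is_derive_continuity_pt, picard_map_derive; auto.
  - intros u _. eapply is_derive_continuity_pt, picard_map_derive; auto.
  - intros u _. now apply picard_map_derive.
  - intros u _. now apply picard_map_derive.
  - intros u j Hu Hj. apply Hxy; auto; lra.
Qed.

Lemma picard_iter_step (x0 : I -> R) (m : nat) (k : I) (t : R) :
  A k -> 0 <= t ->
  Rabs (picard_iter x0 (S m) k t - picard_iter x0 m k t)
    <= B / (2 * K) * (/ 2) ^ m * exp (2 * K * t).
Proof.
  revert k t. induction m as [|m IH]; intros k t Hk Ht.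
  (* The zeroth iterate is constant and equals the first one at time 0, so the first step is a time
     increment, at most [B * t], which is below [B / (2 * K) * exp (2 * K * t)]. *)
  - replace (picard_iter x0 0 k t) with (picard_iter x0 1 k 0)
      by (simpl; now rewrite picard_map_0).
    eapply Rle_trans; [now apply picard_iter_lipschitz|].
    rewrite Rminus_0_r, Rabs_pos_eq, pow_O by lra.
    pose proof (exp_ineq1_le (2 * K * t)).
    replace (B * t) with (B / (2 * K) * 1 * (2 * K * t)) by (field; lra).
    apply Rmult_le_compat_l; [|lra]. rewrite Rmult_1_r.
    apply Rlt_le, Rdiv_lt_0_compat; lra.
  - simpl pow.
    replace (B / (2 * K) * (/ 2 * (/ 2) ^ m))
      with (B / (2 * K) * (/ 2) ^ m / 2) by (field; lra).
    apply (picard_map_contraction x0 (picard_iter x0 (S m)) (picard_iter x0 m)); auto.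
    + apply half_pow_le. apply Rlt_le, Rdiv_lt_0_compat; lra.
    + intros; now apply picard_iter_lipschitz.
    + intros; now apply picard_iter_lipschitz.
Qed.

Lemma picard_iter_cauchy (x0 : I -> R) (m p : nat) (k : I) (t : R) :
  A k -> 0 <= t ->
  Rabs (picard_iter x0 (p + m) k t - picard_iter x0 m k t)
    <= B / K * (/ 2) ^ m * exp (2 * K * t).
Proof.
  intros Hk Ht.
  (* Keeping the subtracted power makes the geometric sum an exact identity, so that the induction
     closes; [B / K] is twice the factor of a single step. *)
  assert (Hp : Rabs (picard_iter x0 (p + m) k t - picard_iter x0 m k t)
    <= B / K * ((/ 2) ^ m - (/ 2) ^ (p + m)) * exp (2 * K * t)).
  { induction p as [|p IH].
    - simpl. rewrite !Rminus_diag, Rabs_R0. lra.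
    - pose proof (picard_iter_step x0 (p + m) k t Hk Ht) as H.
      change (S p + m)%nat with (S (p + m)).
      replace (picard_iter x0 (S (p + m)) k t - picard_iter x0 m k t) with
        ((picard_iter x0 (S (p + m)) k t - picard_iter x0 (p + m) k t)
         + (picard_iter x0 (p + m) k t - picard_iter x0 m k t)) by ring.
      eapply Rle_trans; [apply Rabs_triang|].
      eapply Rle_trans; [apply Rplus_le_compat; [exact H | exact IH]|].
      apply Req_le. simpl pow. field. lra. }
  eapply Rle_trans; [exact Hp|]. apply Rmult_le_compat_r; [apply Rlt_le, exp_pos|].
  apply Rmult_le_compat_l; [apply Rlt_le, Rdiv_lt_0_compat; lra|].
  assert (0 < (/ 2) ^ (p + m)) by (apply pow_lt; lra). lra.
Qed.

Lemma picard_limit (x0 : I -> R) :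
  exists x : I -> R -> R,
    (forall k t u, A k -> Rabs (x k t - x k u) <= B * Rabs (t - u)) /\
    (forall m k t, A k -> 0 <= t ->
       Rabs (x k t - picard_iter x0 m k t)
         <= B / K * (/ 2) ^ m * exp (2 * K * t)).
Proof.
  pose (l := fun k t => real (Lim_seq (fun m => picard_iter x0 m k t))).
  assert (Hl : forall k t, A k -> 0 <= t ->
    is_lim_seq (fun m => picard_iter x0 m k t) (l k t)).
  { intros k t Hk Ht. apply Lim_seq_correct', ex_lim_seq_cauchy_corr.
    intros eps.
    pose (c := B / K * exp (2 * K * t)).
    assert (Hc : 0 < c).
    { apply Rmult_lt_0_compat; [apply Rdiv_lt_0_compat; lra | apply exp_pos]. }
    destruct (pow_lt_1_zero (/ 2)) with (y := eps / (2 * c)) as [N HN].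
    { rewrite Rabs_pos_eq; lra. }
    { apply Rdiv_lt_0_compat; [apply cond_pos | lra]. }
    specialize (HN N (Nat.le_refl N)).
    rewrite Rabs_pos_eq in HN by (apply pow_le; lra).
    apply (Rmult_lt_compat_l (2 * c)) in HN; [|lra].
    replace (2 * c * (eps / (2 * c))) with (pos eps) in HN by (field; lra).
    exists N. intros p q Hp Hq.
    assert (H : forall r, (N <= r)%nat ->
      Rabs (picard_iter x0 r k t - picard_iter x0 N k t) <= c * (/ 2) ^ N).
    { intros r Hr. replace r with (r - N + N)%nat by lia.
      eapply Rle_trans; [now apply picard_iter_cauchy|].
      unfold c. lra. }
    replace (picard_iter x0 p k t - picard_iter x0 q k t) with
      ((picard_iter x0 p k t - picard_iter x0 N k t)
       - (picard_iter x0 q k t - picard_iter x0 N k t)) by ring.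
    eapply Rle_lt_trans; [apply Rabs_triang|]. rewrite Rabs_Ropp.
    pose proof (H p Hp). pose proof (H q Hq). lra. }
  assert (Habs : forall (v : nat -> R) (a : R), is_lim_seq v a ->
    forall b : R, is_lim_seq (fun m => Rabs (v m - b)) (Rabs (a - b))).
  { intros v a Hv b. apply (is_lim_seq_abs (fun m => v m - b) (a - b)).
    apply is_lim_seq_minus'; [exact Hv | apply is_lim_seq_const]. }
  (* The estimates control only [0 <= t]. Freezing the limit at negative times yields the Lipschitz
     bound on the whole line that [picard_map_derive] requires. *)
  exists (fun k t => l k (Rmax 0 t)). split.
  - intros k t u Hk.
    assert (H : Rbar_le (Rabs (l k (Rmax 0 t) - l k (Rmax 0 u)))
                        (B * Rabs (t - u))); [|exact H].
    apply (is_lim_seq_le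
      (fun m => Rabs (picard_iter x0 m k (Rmax 0 t) - picard_iter x0 m k (Rmax 0 u)))
      (fun _ => B * Rabs (t - u))).
    + intros m. eapply Rle_trans; [now apply picard_iter_lipschitz|].
      apply Rmult_le_compat_l; [lra|].
      unfold Rmax. destruct (Rle_dec 0 t), (Rle_dec 0 u);
        unfold Rabs; repeat destruct Rcase_abs; lra.
    + apply (is_lim_seq_abs _ (l k (Rmax 0 t) - l k (Rmax 0 u))).
      apply is_lim_seq_minus'; apply Hl; auto; apply Rmax_l.
    + apply is_lim_seq_const.
  - intros m k t Hk Ht. rewrite Rmax_right by lra.
    assert (H : Rbar_le (Rabs (l k t - picard_iter x0 m k t))
      (B / K * (/ 2) ^ m * exp (2 * K * t))); [|exact H].
    apply (is_lim_seq_le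
      (fun p => Rabs (picard_iter x0 (p + m) k t - picard_iter x0 m k t))
      (fun _ => B / K * (/ 2) ^ m * exp (2 * K * t))).
    + intros p. now apply picard_iter_cauchy.
    + apply Habs. apply (is_lim_seq_incr_n (fun p => picard_iter x0 p k t)).
      now apply Hl.
    + apply is_lim_seq_const.
Qed.

Lemma flow_exists (x0 : I -> R) :
  exists x : I -> R -> R,
    (forall k, x k 0 = x0 k) /\
    forall k t, A k -> 0 <= t -> is_derive (x k) t (F k (fun j => x j t)).
Proof.
  destruct (picard_limit x0) as [x [Hlip Hlim]].
  assert (Hfix : forall k t, A k -> 0 <= t -> picard_map x0 x k t = x k t).
  { intros k t Hk Ht. apply Rminus_diag_uniq.
    apply Rabs_eq_0, Rle_antisym; [|apply Rabs_pos].
    apply (half_pow_lim (B / K * exp (2 * K * t))). intros m.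
    assert (H1 : Rabs (picard_map x0 x k t - picard_iter x0 (S m) k t)
      <= B / K * (/ 2) ^ m / 2 * exp (2 * K * t)).
    { apply (picard_map_contraction x0 x (picard_iter x0 m)); auto.
      - apply half_pow_le, Rlt_le, Rdiv_lt_0_compat; lra.
      - intros; now apply picard_iter_lipschitz. }
    assert (H2 := Hlim (S m) k t Hk Ht). simpl pow in H2.
    rewrite Rabs_minus_sym in H2.
    replace (picard_map x0 x k t - x k t) with
      ((picard_map x0 x k t - picard_iter x0 (S m) k t)
       + (picard_iter x0 (S m) k t - x k t)) by ring.
    eapply Rle_trans; [apply Rabs_triang|].
    replace (B / K * exp (2 * K * t) * (/ 2) ^ m) with
      (B / K * (/ 2) ^ m / 2 * exp (2 * K * t)
       + B / K * (/ 2 * (/ 2) ^ m) * exp (2 * K * t)) by (field; lra).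
    lra. }
  (* The witness is the image of [x] rather than [x]: the two are known to agree only for [0 <= t],
     and the image has a two-sided derivative at 0. *)
  exists (picard_map x0 x). split.
  - intros k. apply picard_map_0.
  - intros k t Hk Ht.
    replace (F k (fun j => picard_map x0 x j t)) with (F k (fun j => x j t)).
    + now apply picard_map_derive.
    + apply Rminus_diag_uniq, Rabs_eq_0, Rle_antisym; [|apply Rabs_pos].
      rewrite <- (Rmult_0_r K). apply F_lipschitz; auto.
      intros j Hj. rewrite Hfix, Rminus_diag, Rabs_R0 by auto. lra.
Qed.

End GlobalFlow.

(** * The uniform chain of cars *)

Lemma sum_n_m_snoc (a : nat -> R) (m : nat) :
  sum_n_m a 1 (S m) = sum_n_m a 1 m + a (S m).
Proof.
  apply (sum_n_Sm a 1 m). lia.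
Qed.

Lemma sum_n_m_ge_term (a : nat -> R) (m i : nat) :
  (forall j, (1 <= j <= m)%nat -> 0 <= a j) -> (1 <= i <= m)%nat ->
  a i <= sum_n_m a 1 m.
Proof.
  intros Ha Hi.
  assert (H0 : forall k, (k <= m)%nat -> 0 <= sum_n_m a 1 k).
  { induction k as [|k IH]; intros Hk.
    - rewrite sum_n_m_zero by lia. apply Rle_refl.
    - rewrite sum_n_m_snoc. apply Rplus_le_le_0_compat; [apply IH; lia|].
      apply Ha. lia. }
  induction m as [|m IH]; [lia|].
  rewrite sum_n_m_snoc. destruct (Nat.eq_dec i (S m)) as [->|Hne].
  - assert (0 <= sum_n_m a 1 m) by (apply H0; lia). lra.
  - assert (0 <= a (S m)) by (apply Ha; lia).
    enough (a i <= sum_n_m a 1 m) by lra.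
    apply IH; [|lia|]; intros; [apply Ha | apply H0]; lia.
Qed.

(* The convention [chain n P s 1 = chain n P s (n + 1) = 0] puts the first, the
   middle and the last car under one equation. *)
Definition chain (n : nat) (P : R -> R) (s : nat -> R) (i : nat) : R :=
  if ((2 <=? i) && (i <=? n))%nat%bool then P (s i) else 0.

Lemma chain_in (n : nat) (P : R -> R) (s : nat -> R) (i : nat) :
  (2 <= i <= n)%nat -> chain n P s i = P (s i).
Proof.
  intros [H1 H2]. unfold chain.
  apply Nat.leb_le in H1. apply Nat.leb_le in H2. now rewrite H1, H2.
Qed.

Lemma chain_out (n : nat) (P : R -> R) (s : nat -> R) (i : nat) :
  ~ (2 <= i <= n)%nat -> chain n P s i = 0.
Proof.
  intros H. unfold chain.
  destruct (Nat.leb_spec 2 i), (Nat.leb_spec i n); auto. lia.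
Qed.

Lemma chain_le0 (n : nat) (P : R -> R) (s : nat -> R) (i : nat) :
  (forall j, (2 <= j <= n)%nat -> P (s j) <= 0) -> chain n P s i <= 0.
Proof.
  intros H. unfold chain.
  destruct (Nat.leb_spec 2 i), (Nat.leb_spec i n); simpl; try lra. apply H; lia.
Qed.

Lemma chain_ge (n : nat) (P : R -> R) (b : R) (s : nat -> R) (i : nat) :
  b <= 0 -> (forall j, (2 <= j <= n)%nat -> b <= P (s j)) -> b <= chain n P s i.
Proof.
  intros Hb H. unfold chain.
  destruct (Nat.leb_spec 2 i), (Nat.leb_spec i n); simpl; try lra. apply H; lia.
Qed.

Lemma chain_lipschitz (n : nat) (P : R -> R) (K d : R) (s s' : nat -> R) (i : nat) :
  0 <= K * d ->
  (forall j, (2 <= j <= n)%nat -> Rabs (P (s j) - P (s' j)) <= K * d) ->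
  Rabs (chain n P s i - chain n P s' i) <= K * d.
Proof.
  intros Hd H. unfold chain.
  destruct (Nat.leb_spec 2 i), (Nat.leb_spec i n); simpl;
    try (rewrite Rminus_diag, Rabs_R0; exact Hd). apply H; lia.
Qed.

Lemma chain_ext (n : nat) (P P' : R -> R) (s : nat -> R) (i : nat) :
  (forall j, (2 <= j <= n)%nat -> P (s j) = P' (s j)) ->
  chain n P s i = chain n P' s i.
Proof.
  intros H. unfold chain.
  destruct (Nat.leb_spec 2 i), (Nat.leb_spec i n); simpl; auto.
Qed.

(** * Truncation of a real number to a segment *)

Definition clamp (a b x : R) : R := Rmax a (Rmin b x).

Lemma clamp_range (a b x : R) : a <= b -> a <= clamp a b x <= b.
Proof.
  intros H. unfold clamp, Rmax, Rmin.
  destruct (Rle_dec b x), (Rle_dec a b), (Rle_dec a x); lra.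
Qed.

Lemma clamp_id (a b x : R) : a <= x <= b -> clamp a b x = x.
Proof.
  intros H. unfold clamp. rewrite Rmin_right, Rmax_right; lra.
Qed.

Lemma clamp_above (a b x : R) : a <= b -> b <= x -> clamp a b x = b.
Proof.
  intros H H'. unfold clamp. rewrite Rmin_left, Rmax_right; lra.
Qed.

Lemma clamp_below (a b x : R) : a <= b -> x <= a -> clamp a b x = a.
Proof.
  intros H H'. unfold clamp. rewrite Rmin_right, Rmax_left; lra.
Qed.

Lemma clamp_lipschitz (a b x y : R) :
  Rabs (clamp a b x - clamp a b y) <= Rabs (x - y).
Proof.
  unfold clamp, Rmax, Rmin, Rabs.
  destruct (Rle_dec b x), (Rle_dec b y); repeat destruct Rle_dec;
    repeat destruct Rcase_abs; lra.
Qed.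

(** * Velocity bounds, energy balance and spacing bound *)

Section Platoon.

Variables (n : nat) (mu vmax vstar : R) (f : R -> R).
Hypothesis mu_pos : 0 < mu.
Hypothesis vstar_pos : 0 < vstar.
Hypothesis vstar_vmax : vstar < vmax.
Hypothesis f_ge : forall x, Rmax x 0 <= f x.

Let g := ACC_g vmax vstar f.

(** This is the acceleration at velocity 0 without the contribution of [mu]. It equals
    [vmax * f x / (vmax - vstar)], and the bound [0 <= f x] gives its sign. *)
Lemma ACC_g_ge_left (x : R) : 0 <= g x * vstar + x.
Proof.
  unfold g, ACC_g.
  replace ((vmax * f x / (vstar * (vmax - vstar)) - x / vstar) * vstar + x)
    with (vmax * f x / (vmax - vstar)) by (field; lra).
  assert (0 <= f x) by (eapply Rle_trans; [apply Rmax_r | apply f_ge]).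
  apply Rdiv_le_0_compat; [nra | lra].
Qed.

(** This is the deceleration at velocity [vmax] without the contribution of [mu]. It equals
    [vmax * (f x - x) / vstar], and the bound [x <= f x] gives its sign. *)
Lemma ACC_g_ge_right (x : R) : 0 <= g x * (vmax - vstar) - x.
Proof.
  unfold g, ACC_g.
  replace ((vmax * f x / (vstar * (vmax - vstar)) - x / vstar) * (vmax - vstar) - x)
    with (vmax * (f x - x) / vstar) by (field; lra).
  assert (x <= f x) by (eapply Rle_trans; [apply Rmax_l | apply f_ge]).
  apply Rdiv_le_0_compat; [nra | lra].
Qed.

(** In the sum of the two preceding bounds the force cancels and [0 <= g x * vmax] remains. *)
Lemma ACC_g_ge0 (x : R) : 0 <= g x.
Proof.
  pose proof (ACC_g_ge_left x). pose proof (ACC_g_ge_right x).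
  destruct (Rle_lt_dec 0 (g x)); [auto | nra].
Qed.

Definition accel (x c : R) : R := - (mu + g x) * (c - vstar) + x.

Lemma accel_above (x c : R) : vmax <= c -> accel x c <= 0.
Proof.
  intros Hc. unfold accel.
  pose proof (ACC_g_ge0 x). pose proof (ACC_g_ge_right x). nra.
Qed.

Lemma accel_below (x c : R) : c <= 0 -> 0 <= accel x c.
Proof.
  intros Hc. unfold accel.
  pose proof (ACC_g_ge0 x). pose proof (ACC_g_ge_left x). nra.
Qed.

(* [P] stands for V' or a truncation of it, and [cl] for the identity or the
   truncation of velocities to [[0, vmax]]. *)
Record trajectory (P cl : R -> R) (T : R) (s v : nat -> R -> R) : Prop := {
  traj_s_cont : forall i t, (2 <= i <= n)%nat -> 0 <= t < T -> continuity_pt (s i) t;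
  traj_v_cont : forall i t, (1 <= i <= n)%nat -> 0 <= t < T -> continuity_pt (v i) t;
  traj_s : forall i t, (2 <= i <= n)%nat -> 0 < t < T ->
    is_derive (s i) t (cl (v (i - 1)%nat t) - cl (v i t));
  traj_v : forall i t, (1 <= i <= n)%nat -> 0 < t < T ->
    is_derive (v i) t
      (accel (chain n P (fun j => s j t) i - chain n P (fun j => s j t) (S i))
             (cl (v i t))) }.

(** Removes a truncation that is inactive along the curve, or inserts one into a solution of the
    original equations. *)
Lemma trajectory_congr (P P' cl cl' : R -> R) (T : R) (s v : nat -> R -> R) :
  trajectory P cl T s v ->
  (forall i t, (2 <= i <= n)%nat -> 0 < t < T -> P (s i t) = P' (s i t)) ->
  (forall i t, (1 <= i <= n)%nat -> 0 < t < T -> cl (v i t) = cl' (v i t)) ->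
  trajectory P' cl' T s v.
Proof.
  intros [cs cv Ds Dv] HP Hcl. constructor; auto.
  - intros i t Hi Ht. rewrite <- !Hcl by (auto; lia). now apply Ds.
  - intros i t Hi Ht.
    rewrite <- (chain_ext n P P' (fun j => s j t) i) by auto.
    rewrite <- (chain_ext n P P' (fun j => s j t) (S i)) by auto.
    rewrite <- Hcl by auto. now apply Dv.
Qed.

(** Outside the admissible range the sign of [accel] does not depend on the force, so the bound
    holds for any [P], before anything is known about the spacings. *)
Lemma velocity_range (P cl : R -> R) (T : R) (s v : nat -> R -> R) :
  trajectory P cl T s v ->
  (forall c, vmax <= c -> vmax <= cl c) -> (forall c, c <= 0 -> cl c <= 0) ->
  (forall i, (1 <= i <= n)%nat -> 0 <= v i 0 <= vmax) ->
  forall i t, (1 <= i <= n)%nat -> 0 <= t < T -> 0 <= v i t <= vmax.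
Proof.
  intros HT Ha Hb H0 i t Hi Ht. destruct (H0 i Hi). split.
  - enough (- v i t <= 0) by lra.
    apply (barrier (fun t => - v i t) (fun t => - accel
      (chain n P (fun j => s j t) i - chain n P (fun j => s j t) (S i))
      (cl (v i t))) 0); try lra.
    + intros u Hu. apply continuity_pt_opp. apply (traj_v_cont _ _ _ _ _ HT); auto; lra.
    + intros u Hu. apply (is_derive_opp (v i)), (traj_v _ _ _ _ _ HT); auto; lra.
    + intros u Hu Hneg. apply Rge_le, Ropp_0_le_ge_contravar, accel_below, Hb. lra.
  - apply (barrier (v i) (fun t => accel
      (chain n P (fun j => s j t) i - chain n P (fun j => s j t) (S i))
      (cl (v i t))) 0); try lra.
    + intros u Hu. apply (traj_v_cont _ _ _ _ _ HT); auto; lra.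
    + intros u Hu. apply (traj_v _ _ _ _ _ HT); auto; lra.
    + intros u Hu Hneg. apply accel_above, Ha. lra.
Qed.

(** Each car carries the potential of the gap ahead of it; car 1 carries none, since [chain]
    vanishes at 1. *)
Definition energy (U : R -> R) (s v : nat -> R) : R :=
  sum_n_m (fun i => (v i - vstar) ^ 2 / 2 + chain n U s i) 1 n.

Lemma energy_ext (U U' : R -> R) (s s' v v' : nat -> R) :
  (forall i, (2 <= i <= n)%nat -> U (s i) = U' (s' i)) ->
  (forall i, (1 <= i <= n)%nat -> v i = v' i) ->
  energy U s v = energy U' s' v'.
Proof.
  intros Hs Hv. apply sum_n_m_ext_loc. intros i Hi. rewrite Hv by auto.
  f_equal. unfold chain. destruct (Nat.leb_spec 2 i), (Nat.leb_spec i n); simpl; auto.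
Qed.

Lemma energy_ge_term (U : R -> R) (s v : nat -> R) (i : nat) :
  (forall j, (2 <= j <= n)%nat -> 0 <= U (s j)) -> (1 <= i <= n)%nat ->
  chain n U s i <= energy U s v.
Proof.
  intros HU Hi.
  assert (H0 : forall j, 0 <= chain n U s j) by (intros j; apply chain_ge; auto; lra).
  assert (H : (v i - vstar) ^ 2 / 2 + chain n U s i <= energy U s v).
  { apply (sum_n_m_ge_term (fun i => (v i - vstar) ^ 2 / 2 + chain n U s i)); auto.
    intros j _. specialize (H0 j). pose proof (pow2_ge_0 (v j - vstar)). lra. }
  pose proof (pow2_ge_0 (v i - vstar)). lra.
Qed.

Definition dissipation (P : R -> R) (s v : nat -> R) : R :=
  sum_n_m (fun i => (mu + g (chain n P s i - chain n P s (S i))) * (v i - vstar) ^ 2)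
    1 n.

Lemma dissipation_ge_term (P : R -> R) (s v : nat -> R) (i : nat) :
  (1 <= i <= n)%nat -> mu * (v i - vstar) ^ 2 <= dissipation P s v.
Proof.
  intros Hi. unfold dissipation.
  eapply Rle_trans; [|apply (sum_n_m_ge_term _ n i); auto].
  - cbv beta. pose proof (pow2_ge_0 (v i - vstar)).
    pose proof (ACC_g_ge0 (chain n P s i - chain n P s (S i))). nra.
  - intros j _. pose proof (pow2_ge_0 (v j - vstar)).
    pose proof (ACC_g_ge0 (chain n P s j - chain n P s (S j))). nra.
Qed.

(* The power exchanged between the cars telescopes: the partial energy of the
   first [m] cars only loses [(v_m - vstar) p_(m+1)] besides the dissipation. *)
Lemma energy_derive (P U : R -> R) (T t : R) (s v : nat -> R -> R) :
  trajectory P (fun c => c) T s v -> 0 < t < T ->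
  (forall i, (2 <= i <= n)%nat -> is_derive U (s i t) (P (s i t))) ->
  is_derive (fun t => energy U (fun i => s i t) (fun i => v i t)) t
    (- dissipation P (fun i => s i t) (fun i => v i t)).
Proof.
  intros HT Ht HU. unfold energy, dissipation.
  set (p := chain n P (fun j => s j t)).
  set (e := fun i u => (v i u - vstar) ^ 2 / 2 + chain n U (fun j => s j u) i).
  set (k := fun i => (mu + g (p i - p (S i))) * (v i t - vstar) ^ 2).
  assert (De : forall m, (S m <= n)%nat -> is_derive (e (S m)) t
    (- k (S m) + (v m t - vstar) * p (S m) - (v (S m) t - vstar) * p (S (S m)))).
  { intros m Hm. unfold e.
    replace (- k (S m) + (v m t - vstar) * p (S m) - (v (S m) t - vstar) * p (S (S m)))
      with (plus ((v (S m) t - vstar) * accel (p (S m) - p (S (S m))) (v (S m) t))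
                 (p (S m) * (v m t - v (S m) t)))
      by (unfold k, accel, plus; simpl; ring).
    apply (is_derive_plus (fun u => (v (S m) u - vstar) ^ 2 / 2)
      (fun u => chain n U (fun j => s j u) (S m))).
    - assert (Dv := traj_v _ _ _ _ _ HT (S m) t ltac:(lia) Ht).
      cbv beta in Dv. fold p in Dv.
      assert (Dq : is_derive (fun c => (c - vstar) ^ 2 / 2) (v (S m) t)
        (v (S m) t - vstar)) by (auto_derive; auto; field).
      rewrite Rmult_comm.
      exact (is_derive_comp (fun c => (c - vstar) ^ 2 / 2) (v (S m)) t _ _ Dq Dv).
    (* For [m = 0] there is no car ahead: the arbitrary value [v 0] is multiplied by [p 1 = 0]. *)
    - destruct (Nat.eq_dec m 0) as [->|Hne].
      + unfold p. rewrite (chain_out n P) by lia. rewrite Rmult_0_l.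
        apply (is_derive_ext (fun _ => 0)).
        * intros u. now rewrite chain_out by lia.
        * apply (is_derive_const 0).
      + unfold p. rewrite (chain_in n P) by lia.
        apply (is_derive_ext (fun u => U (s (S m) u))).
        * intros u. now rewrite chain_in by lia.
        * rewrite Rmult_comm.
          assert (Ds := traj_s _ _ _ _ _ HT (S m) t ltac:(lia) Ht).
          replace (S m - 1)%nat with m in Ds by lia.
          exact (is_derive_comp U (s (S m)) t _ _ (HU (S m) ltac:(lia)) Ds). }
  assert (Hm : forall m, (m <= n)%nat ->
    is_derive (fun u => sum_n_m (fun i => e i u) 1 m) t
      (- sum_n_m k 1 m - (v m t - vstar) * p (S m))).
  { induction m as [|m IH]; intros Hm.
    - rewrite sum_n_m_zero by lia.
      assert (Hp : p 1%nat = 0) by (apply chain_out; lia). rewrite Hp.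
      replace (- zero - (v 0%nat t - vstar) * 0) with 0 by (unfold zero; simpl; ring).
      apply (is_derive_ext (fun _ => 0)).
      + intros u. now rewrite sum_n_m_zero by lia.
      + apply (is_derive_const 0).
    - apply (is_derive_ext (fun u => sum_n_m (fun i => e i u) 1 m + e (S m) u)).
      { intros u. now rewrite sum_n_m_snoc. }
      rewrite sum_n_m_snoc.
      replace (- (sum_n_m k 1 m + k (S m)) - (v (S m) t - vstar) * p (S (S m)))
        with (plus (- sum_n_m k 1 m - (v m t - vstar) * p (S m))
          (- k (S m) + (v m t - vstar) * p (S m) - (v (S m) t - vstar) * p (S (S m))))
        by (unfold plus; simpl; ring).
      apply (is_derive_plus (fun u => sum_n_m (fun i => e i u) 1 m) (e (S m))).
      + apply IH. lia.
      + now apply De. }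
  specialize (Hm n (Nat.le_refl n)).
  assert (Hp : p (S n) = 0) by (apply chain_out; lia).
  rewrite Hp, Rmult_0_r, Rminus_0_r in Hm. exact Hm.
Qed.

(** Serves at time 0, where [trajectory] provides no derivative. *)
Lemma energy_continuity_pt (P U cl : R -> R) (T t : R) (s v : nat -> R -> R) :
  trajectory P cl T s v -> 0 <= t < T ->
  (forall i, (2 <= i <= n)%nat -> continuity_pt U (s i t)) ->
  continuity_pt (fun t => energy U (fun i => s i t) (fun i => v i t)) t.
Proof.
  intros HT Ht HU. unfold energy.
  set (e := fun i u => (v i u - vstar) ^ 2 / 2 + chain n U (fun j => s j u) i).
  assert (Hm : forall m, (m <= n)%nat ->
    continuity_pt (fun u => sum_n_m (fun i => e i u) 1 m) t).
  { induction m as [|m IH]; intros Hm.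
    - apply (continuity_pt_ext (fun _ => 0)).
      + intros u. now rewrite sum_n_m_zero by lia.
      + apply continuity_pt_const. intros ? ?; auto.
    - apply (continuity_pt_ext (fun u => sum_n_m (fun i => e i u) 1 m + e (S m) u)).
      { intros u. now rewrite sum_n_m_snoc. }
      apply continuity_pt_plus; [apply IH; lia|].
      apply continuity_pt_plus.
      + apply (continuity_pt_comp (v (S m)) (fun c => (c - vstar) ^ 2 / 2)).
        * apply (traj_v_cont _ _ _ _ _ HT); auto; lia.
        * apply (is_derive_continuity_pt _ _ (v (S m) t - vstar)).
          auto_derive; auto; field.
      + destruct (Nat.eq_dec m 0) as [->|Hne].
        * apply (continuity_pt_ext (fun _ => 0)).
          -- intros u. now rewrite chain_out by lia.
          -- apply continuity_pt_const. intros ? ?; auto.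
        * apply (continuity_pt_ext (fun u => U (s (S m) u))).
          -- intros u. now rewrite chain_in by lia.
          -- apply (continuity_pt_comp (s (S m)) U).
             ++ apply (traj_s_cont _ _ _ _ _ HT); auto; lia.
             ++ apply HU; lia. }
  exact (Hm n (Nat.le_refl n)).
Qed.

Lemma energy_nonincreasing (P U : R -> R) (T a b : R) (s v : nat -> R -> R) :
  (1 <= n)%nat ->
  trajectory P (fun c => c) T s v -> 0 <= a <= b -> b < T ->
  (forall i t, (2 <= i <= n)%nat -> 0 <= t < T ->
     is_derive U (s i t) (P (s i t))) ->
  energy U (fun i => s i b) (fun i => v i b)
    <= energy U (fun i => s i a) (fun i => v i a).
Proof.
  intros Hn HT Hab HbT HU.
  enough (energy U (fun i => s i b) (fun i => v i b)
    - energy U (fun i => s i a) (fun i => v i a) <= 0 - 0) by lra.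
  apply (derive_le_increment
    (fun t => energy U (fun i => s i t) (fun i => v i t)) (fun _ => 0)
    (fun t => - dissipation P (fun i => s i t) (fun i => v i t)) (fun _ => 0)).
  - lra.
  - intros t Ht. apply (energy_continuity_pt P U (fun c => c) T); auto; try lra.
    intros i Hi. eapply is_derive_continuity_pt, HU; auto; lra.
  - intros. apply continuity_pt_const. intros ? ?; auto.
  - intros t Ht. apply (energy_derive P U T); auto; try lra.
    intros i Hi. apply HU; auto; lra.
  - intros. apply (is_derive_const 0).
  - intros t Ht.
    pose proof (dissipation_ge_term P (fun i => s i t) (fun i => v i t) 1 ltac:(lia)).
    cbv beta in H. pose proof (pow2_ge_0 (v 1%nat t - vstar)). nra.
Qed.

(** The integrating factor [E u = exp (mu * (u - r))] leaves the derivative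
    [(x u - k u * w u) * E u]. Its sign is known only where [w] is positive, which the level
    [C >= 0] of the barrier guarantees. *)
Lemma damped_decay (w k x : R -> R) (r t C : R) :
  r <= t -> 0 <= C -> w r <= C ->
  (forall u, r <= u <= t -> continuity_pt w u) ->
  (forall u, r < u < t -> is_derive w u (- (mu + k u) * w u + x u)) ->
  (forall u, r < u < t -> 0 <= k u) -> (forall u, r < u < t -> x u <= 0) ->
  w t <= C * exp (- mu * (t - r)).
Proof.
  intros Hrt HC Hw cw Dw Hk Hx.
  pose (E := fun u => exp (mu * (u - r))).
  assert (DE : forall u, is_derive E u (mu * E u)).
  { intros u. unfold E. auto_derive; auto. rewrite Rmult_1_r. reflexivity. }
  assert (HE : forall u, 0 < E u) by (intros u; apply exp_pos).
  assert (Hz : w t * E t <= C).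
  { apply (barrier (fun u => w u * E u)
      (fun u => (- (mu + k u) * w u + x u) * E u + w u * (mu * E u)) r).
    - exact Hrt.
    - intros u Hu. apply continuity_pt_mult; auto.
      eapply is_derive_continuity_pt, DE.
    - intros u Hu. apply (is_derive_mult w E); auto. intros; apply Rmult_comm.
    - intros u Hu Hgt. specialize (HE u).
      assert (0 < w u) by (destruct (Rlt_le_dec 0 (w u)); auto; nra).
      specialize (Hk u Hu). specialize (Hx u Hu).
      assert (0 <= k u * w u) by nra.
      replace ((- (mu + k u) * w u + x u) * E u + w u * (mu * E u))
        with ((x u - k u * w u) * E u) by ring. nra.
    - unfold E. rewrite Rminus_diag, Rmult_0_r, exp_0. lra. }
  assert (HEE : E t * exp (- mu * (t - r)) = 1).
  { unfold E. rewrite <- exp_plus, <- exp_0. f_equal. ring. }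
  replace (w t) with (w t * E t * exp (- mu * (t - r))) by (rewrite Rmult_assoc, HEE; ring).
  apply Rmult_le_compat_r; auto. apply Rlt_le, exp_pos.
Qed.

(* After the last time at which [s_i] equals the threshold the pair (i-1, i) does
   not interact, so that the excess speed of car i-1 and the deficit of car i
   both decay like [exp (- mu t)]. *)
Lemma spacing_bound (P : R -> R) (lambda T t : R) (s v : nat -> R -> R) (i : nat) :
  trajectory P (fun c => c) T s v ->
  (forall j u, (1 <= j <= n)%nat -> 0 <= u < T -> 0 <= v j u <= vmax) ->
  (forall j u, (2 <= j <= n)%nat -> 0 <= u < T -> P (s j u) <= 0) ->
  (forall x, lambda <= x -> P x = 0) ->
  (2 <= i <= n)%nat -> 0 <= t < T ->
  s i t <= Rmax lambda (s i 0) + / mu * vmax.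
Proof.
  intros HT Hv HP HPl Hi Ht. apply Rnot_lt_le. intros Hgt.
  set (M := Rmax lambda (s i 0)) in *.
  assert (HMl : lambda <= M) by apply Rmax_l.
  assert (HM0 : s i 0 <= M) by apply Rmax_r.
  assert (Hmu : 0 < / mu) by (now apply Rinv_0_lt_compat).
  assert (Hvm : 0 < / mu * vmax) by (apply Rmult_lt_0_compat; lra).
  destruct (last_crossing (s i) 0 t M) as [r [Hr [Hsr Hs]]]; try lra.
  { intros u Hu. apply (traj_s_cont _ _ _ _ _ HT); auto; lra. }
  assert (Hpi : forall u, r < u <= t -> chain n P (fun j => s j u) i = 0).
  { intros u Hu. rewrite chain_in by auto. apply HPl. specialize (Hs u Hu). lra. }
  assert (Hple : forall u j, r < u <= t -> chain n P (fun j => s j u) j <= 0).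
  { intros u j Hu. apply chain_le0. intros k Hk. apply HP; auto; lra. }
  assert (Hi1 : S (i - 1) = i) by lia.
  (* Since p_i = 0 here, car i-1 feels only p_(i-1) <= 0 from the gap ahead of it, and car i feels
     only - p_(i+1) >= 0 from the gap behind it. *)
  assert (H1 : forall u, r <= u <= t ->
    v (i - 1)%nat u - vstar <= (vmax - vstar) * exp (- mu * (u - r))).
  { intros u Hu.
    apply (damped_decay (fun u => v (i - 1)%nat u - vstar)
      (fun u => g (chain n P (fun j => s j u) (i - 1) - chain n P (fun j => s j u) i))
      (fun u => chain n P (fun j => s j u) (i - 1) - chain n P (fun j => s j u) i));
      try lra.
    - destruct (Hv (i - 1)%nat r); [lia | lra | lra].
    - intros y Hy. apply continuity_pt_minus.
      + apply (traj_v_cont _ _ _ _ _ HT); [lia | lra].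
      + apply continuity_pt_const. intros ? ?; auto.
    - intros y Hy.
      assert (Dv := traj_v _ _ _ _ _ HT (i - 1) y ltac:(lia) ltac:(lra)).
      rewrite Hi1 in Dv. unfold accel in Dv.
      rewrite <- Rminus_0_r.
      apply (is_derive_minus (v (i - 1)%nat) (fun _ => vstar) y _ 0 Dv).
      apply (is_derive_const vstar).
    - intros y _. apply ACC_g_ge0.
    - intros y Hy. rewrite Hpi by lra. specialize (Hple y (i - 1)%nat ltac:(lra)).
      lra. }
  assert (H2 : forall u, r <= u <= t ->
    vstar - v i u <= vstar * exp (- mu * (u - r))).
  { intros u Hu.
    apply (damped_decay (fun u => vstar - v i u)
      (fun u => g (chain n P (fun j => s j u) i - chain n P (fun j => s j u) (S i)))
      (fun u => - (chain n P (fun j => s j u) i - chain n P (fun j => s j u) (S i))));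
      try lra.
    - destruct (Hv i r); [lia | lra | lra].
    - intros y Hy. apply continuity_pt_minus.
      + apply continuity_pt_const. intros ? ?; auto.
      + apply (traj_v_cont _ _ _ _ _ HT); [lia | lra].
    - intros y Hy.
      assert (Dv := traj_v _ _ _ _ _ HT i y ltac:(lia) ltac:(lra)).
      unfold accel in Dv.
      match type of Dv with is_derive _ _ ?d => set (d' := d) in Dv end.
      match goal with |- is_derive _ _ ?e => replace e with (minus 0 d') end.
      + apply (is_derive_minus (fun _ => vstar) (v i) y 0 d'); auto.
        apply (is_derive_const vstar).
      + unfold d', minus, plus, opp. simpl. ring.
    - intros y _. apply ACC_g_ge0.
    - intros y Hy. rewrite Hpi by lra. specialize (Hple y (S i) ltac:(lra)). lra. }
  (* The amplitudes [vmax - vstar] and [vstar] of the two decays add up to [vmax]. The primitive [w]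
     of the resulting rate increases by less than [/ mu * vmax] in total, whence the constant of the
     bound. *)
  pose (w := fun u => - (/ mu * vmax) * exp (- mu * (u - r))).
  assert (Dw : forall u, is_derive w u (vmax * exp (- mu * (u - r)))).
  { intros u. unfold w. auto_derive; auto. change (u + - r) with (u - r). field. lra. }
  assert (H : s i t - s i r <= w t - w r).
  { apply (derive_le_increment (s i) w (fun u => v (i - 1)%nat u - v i u)
      (fun u => vmax * exp (- mu * (u - r)))); try lra.
    - intros u Hu. apply (traj_s_cont _ _ _ _ _ HT); auto; lra.
    - intros u _. eapply is_derive_continuity_pt, Dw.
    - intros u Hu. apply (traj_s _ _ _ _ _ HT); auto; lra.
    - intros u _. apply Dw.
    - intros u Hu. specialize (H1 u ltac:(lra)). specialize (H2 u ltac:(lra)). lra. }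
  unfold w in H. rewrite Rminus_diag, Rmult_0_r, exp_0 in H.
  assert (0 < / mu * vmax * exp (- mu * (t - r)))
    by (apply Rmult_lt_0_compat; [lra | apply exp_pos]).
  lra.
Qed.

(** * Truncated dynamics and asymptotics *)

(** The damping is a product, Lipschitz where both its factors are bounded; hence the restriction of
    the force to a segment and of the velocity to its range. The last bound later shows that the
    damping vanishes in the limit. *)
Lemma accel_regular (b : R) :
  0 <= b -> class_C1 f ->
  exists K B, 0 < K /\ 0 < B /\
    (forall x y c d, - b <= x <= b -> - b <= y <= b ->
       0 <= c <= vmax -> 0 <= d <= vmax ->
       Rabs (accel x c - accel y d) <= K * (Rabs (x - y) + Rabs (c - d))) /\
    (forall x c, - b <= x <= b -> 0 <= c <= vmax -> Rabs (accel x c) <= B) /\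
    (forall x, - b <= x <= b -> mu + g x <= B).
Proof.
  intros Hb Hf.
  destruct (C1_lipschitz_segment f (Derive f) (- b) b) as [Kf [HKf Hlip]].
  { lra. }
  { intros x _. apply Derive_correct, Hf. }
  { intros x _. apply continuity_pt_filterlim. apply (Hf x). }
  set (a := vmax / (vstar * (vmax - vstar))).
  assert (Ha : 0 < a) by (apply Rdiv_lt_0_compat; nra).
  assert (Hiv : 0 < / vstar) by (now apply Rinv_0_lt_compat).
  set (Kg := a * Kf + / vstar).
  assert (HKg : 0 < Kg) by (unfold Kg; nra).
  assert (Hg : forall x y, - b <= x <= b -> - b <= y <= b ->
    Rabs (g x - g y) <= Kg * Rabs (x - y)).
  { intros x y Hx Hy.
    replace (g x - g y) with (a * (f x - f y) + / vstar * (y - x))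
      by (unfold g, ACC_g, a; field; lra).
    eapply Rle_trans; [apply Rabs_triang|]. rewrite !Rabs_mult.
    rewrite (Rabs_pos_eq a), (Rabs_pos_eq (/ vstar)), (Rabs_minus_sym y x) by lra.
    specialize (Hlip x y Hx Hy). unfold Kg. nra. }
  set (G := mu + g 0 + Kg * b).
  assert (Hg0 := ACC_g_ge0 0).
  assert (HG : forall x, - b <= x <= b -> mu + g x <= G).
  { intros x Hx. specialize (Hg x 0 Hx ltac:(lra)). rewrite Rminus_0_r in Hg.
    assert (Rabs x <= b) by (apply Rabs_le; lra).
    apply Rabs_le_between in Hg. unfold G. nra. }
  assert (HG0 : 0 < G) by (unfold G; nra).
  assert (Hc : forall c, 0 <= c <= vmax -> Rabs (c - vstar) <= vmax).
  { intros c Hc. apply Rabs_le. lra. }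
  (* In the Lipschitz constant, [G] comes from the change of velocity, [Kg * vmax] from that of [g],
     and 1 from the force itself. In the bound, [G * vmax + b] dominates [accel], and the further
     [G] dominates [mu + g x]. *)
  exists (G + Kg * vmax + 1), (G * (vmax + 1) + b).
  assert (0 < Kg * vmax) by nra. assert (0 < G * vmax) by nra.
  split; [lra|]. split; [lra|]. split; [|split].
  - intros x y c d Hx Hy Hc1 Hd1. unfold accel.
    replace (- (mu + g x) * (c - vstar) + x - (- (mu + g y) * (d - vstar) + y))
      with (- ((mu + g x) * (c - d)) + (- ((g x - g y) * (d - vstar)) + (x - y)))
      by ring.
    eapply Rle_trans; [apply Rabs_triang|].
    eapply Rle_trans; [apply Rplus_le_compat_l, Rabs_triang|].
    rewrite !Rabs_Ropp, !Rabs_mult.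
    pose proof (ACC_g_ge0 x). specialize (HG x Hx). specialize (Hg x y Hx Hy).
    specialize (Hc d Hd1).
    rewrite (Rabs_pos_eq (mu + g x)) by lra.
    pose proof (Rabs_pos (x - y)). pose proof (Rabs_pos (c - d)).
    pose proof (Rabs_pos (g x - g y)).
    assert ((mu + g x) * Rabs (c - d) <= G * Rabs (c - d)) by nra.
    assert (Rabs (g x - g y) * Rabs (d - vstar) <= Kg * Rabs (x - y) * vmax)
      by (apply Rmult_le_compat; auto; apply Rabs_pos).
    assert (0 <= Kg * vmax * Rabs (c - d)) by (apply Rmult_le_pos; lra).
    assert (0 <= G * Rabs (x - y)) by (apply Rmult_le_pos; lra).
    lra.
  - intros x c Hx Hc1. unfold accel.
    eapply Rle_trans; [apply Rabs_triang|].
    rewrite Rabs_mult, Rabs_Ropp.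
    pose proof (ACC_g_ge0 x). specialize (HG x Hx). specialize (Hc c Hc1).
    rewrite (Rabs_pos_eq (mu + g x)) by lra.
    assert (Rabs x <= b) by (apply Rabs_le; lra).
    assert ((mu + g x) * Rabs (c - vstar) <= G * vmax)
      by (apply Rmult_le_compat; auto; try apply Rabs_pos; lra).
    lra.
  - intros x Hx. specialize (HG x Hx). lra.
Qed.

Section Truncation.

Variables (P : R -> R) (b KP : R).
Hypothesis f_C1 : class_C1 f.
Hypothesis KP_pos : 0 < KP.
Hypothesis P_range : forall x, - b <= P x <= 0.
Hypothesis P_lipschitz : forall x y, Rabs (P x - P y) <= KP * Rabs (x - y).

Lemma chain_diff_range (x : nat -> R) (i : nat) :
  - b <= chain n P x i - chain n P x (S i) <= b.
Proof.
  pose proof (P_range 0).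
  assert (forall j, - b <= chain n P x j <= 0).
  { intros j. split; [apply chain_ge | apply chain_le0]; intros; try apply P_range.
    lra. }
  pose proof (H0 i). pose proof (H0 (S i)). lra.
Qed.

(** The sum type merges both families into the single state of the abstract flow: [inl] for
    spacings, [inr] for velocities. *)
Definition truncated_field (k : nat + nat) (x : nat + nat -> R) : R :=
  match k with
  | inl i => clamp 0 vmax (x (inr (i - 1)%nat)) - clamp 0 vmax (x (inr i))
  | inr i => accel (chain n P (fun j => x (inl j)) i
                    - chain n P (fun j => x (inl j)) (S i))
                   (clamp 0 vmax (x (inr i)))
  end.

Definition coordinate (k : nat + nat) : Prop :=
  match k with inl i => (2 <= i <= n)%nat | inr i => (1 <= i <= n)%nat end.

Lemma truncated_field_regular :
  exists K B, 0 < K /\ 0 < B /\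
    (forall x y d, (forall j, coordinate j -> Rabs (x j - y j) <= d) ->
       forall k, coordinate k ->
       Rabs (truncated_field k x - truncated_field k y) <= K * d) /\
    (forall k x, coordinate k -> Rabs (truncated_field k x) <= B).
Proof.
  assert (Hb : 0 <= b) by (pose proof (P_range 0); lra).
  destruct (accel_regular b Hb f_C1) as [K [B [HK [HB [Hlip [Hbd _]]]]]].
  assert (Hcl : forall c, 0 <= clamp 0 vmax c <= vmax)
    by (intros c; apply clamp_range; lra).
  (* A spacing rate involves two velocities, whence 2. An acceleration involves two forces, each
     [KP]-Lipschitz in the spacings, and one velocity, whence [2 * KP + 1]. *)
  exists (K * (2 * KP + 1) + 2), (B + vmax).
  assert (0 < K * KP) by nra.
  split; [lra|]. split; [lra|]. split.
  - intros x y d Hxy k Hk.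
    assert (Hd : 0 <= d) by (eapply Rle_trans; [apply Rabs_pos | exact (Hxy k Hk)]).
    assert (0 <= K * KP * d) by nra. assert (0 <= K * d) by nra.
    assert (Hcld : forall i, (1 <= i <= n)%nat ->
      Rabs (clamp 0 vmax (x (inr i)) - clamp 0 vmax (y (inr i))) <= d).
    { intros i Hi. eapply Rle_trans; [apply clamp_lipschitz | now apply Hxy]. }
    destruct k as [i|i]; simpl in *.
    + assert (C1 := Hcld i ltac:(lia)).
      assert (C2 := Hcld (i - 1)%nat ltac:(lia)).
      apply Rabs_le_between in C1. apply Rabs_le_between in C2.
      eapply Rle_trans with (2 * d); [apply Rabs_le|]; lra.
    + eapply Rle_trans.
      { apply Hlip; auto; apply chain_diff_range. }
      assert (Hch : forall j, Rabs (chain n P (fun j => x (inl j)) j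
        - chain n P (fun j => y (inl j)) j) <= KP * d).
      { intros j. apply chain_lipschitz; [nra|]. intros l Hl.
        eapply Rle_trans; [apply P_lipschitz|].
        apply Rmult_le_compat_l; [lra|]. now apply (Hxy (inl l)). }
      assert (C1 := Hch i). assert (C2 := Hch (S i)). assert (C3 := Hcld i Hk).
      apply Rle_trans with (K * (2 * (KP * d) + d)); [|lra].
      apply Rmult_le_compat_l; [lra|]. apply Rplus_le_compat; auto.
      apply Rabs_le_between in C1. apply Rabs_le_between in C2. apply Rabs_le. lra.
  - intros [i|i] x Hk; simpl.
    + pose proof (Hcl (x (inr i))). pose proof (Hcl (x (inr (i - 1)%nat))).
      apply Rabs_le. lra.
    + eapply Rle_trans; [apply Hbd; auto; apply chain_diff_range | lra].
Qed.

Lemma truncated_flow_exists (s0 v0 : nat -> R) :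
  exists s v : nat -> R -> R,
    (forall i, s i 0 = s0 i) /\ (forall i, v i 0 = v0 i) /\
    (forall i t, (2 <= i <= n)%nat -> 0 <= t -> is_derive (s i) t
       (clamp 0 vmax (v (i - 1)%nat t) - clamp 0 vmax (v i t))) /\
    (forall i t, (1 <= i <= n)%nat -> 0 <= t -> is_derive (v i) t
       (accel (chain n P (fun j => s j t) i - chain n P (fun j => s j t) (S i))
              (clamp 0 vmax (v i t)))).
Proof.
  destruct truncated_field_regular as [K [B [HK [HB [Hlip Hbd]]]]].
  destruct (flow_exists _ coordinate truncated_field K B HK HB Hlip Hbd
    (fun k => match k with inl i => s0 i | inr i => v0 i end)) as [x [H0 Dx]].
  exists (fun i => x (inl i)), (fun i => x (inr i)).
  split; [|split; [|split]].
  - intros i. apply H0.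
  - intros i. apply H0.
  - intros i t Hi Ht. exact (Dx (inl i) t Hi Ht).
  - intros i t Hi Ht. exact (Dx (inr i) t Hi Ht).
Qed.

Lemma trajectory_unique (T : R) (s v s' v' : nat -> R -> R) :
  trajectory P (clamp 0 vmax) T s v -> trajectory P (clamp 0 vmax) T s' v' ->
  (forall i, (2 <= i <= n)%nat -> s i 0 = s' i 0) ->
  (forall i, (1 <= i <= n)%nat -> v i 0 = v' i 0) ->
  forall t, 0 <= t < T ->
    (forall i, (2 <= i <= n)%nat -> s i t = s' i t) /\
    (forall i, (1 <= i <= n)%nat -> v i t = v' i t).
Proof.
  intros HT HT' Hs Hv t Ht.
  destruct truncated_field_regular as [K [B [HK [HB [Hlip Hbd]]]]].
  assert (H : forall k, coordinate k ->
    match k with inl i => s i | inr i => v i end t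
    = match k with inl i => s' i | inr i => v' i end t).
  { intros k Hk.
    apply (flow_unique _ coordinate truncated_field K B HK HB Hlip Hbd
      (fun k => match k with inl i => s i | inr i => v i end)
      (fun k => match k with inl i => s' i | inr i => v' i end) T); auto.
    - intros [i|i] Hi; [now apply Hs | now apply Hv].
    - intros [i|i] u Hi Hu; [apply (traj_s_cont _ _ _ _ _ HT)
                            | apply (traj_v_cont _ _ _ _ _ HT)]; auto.
    - intros [i|i] u Hi Hu; [apply (traj_s_cont _ _ _ _ _ HT')
                            | apply (traj_v_cont _ _ _ _ _ HT')]; auto.
    - intros [i|i] u Hi Hu; [apply (traj_s _ _ _ _ _ HT)
                            | apply (traj_v _ _ _ _ _ HT)]; auto.
    - intros [i|i] u Hi Hu; [apply (traj_s _ _ _ _ _ HT')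
                            | apply (traj_v _ _ _ _ _ HT')]; auto. }
  split; intros i Hi; [exact (H (inl i) Hi) | exact (H (inr i) Hi)].
Qed.

(** * Convergence of the velocities and of the forces *)

Variables (U : R -> R) (s v : nat -> R -> R).
Hypothesis sv_trajectory : forall T, trajectory P (fun c => c) T s v.
Hypothesis v_range : forall i t, (1 <= i <= n)%nat -> 0 <= t -> 0 <= v i t <= vmax.
Hypothesis U_derive : forall x, is_derive U x (P x).
Hypothesis U_ge0 : forall x, 0 <= U x.

Lemma velocity_lipschitz :
  exists B, 0 < B /\ forall i t u, (1 <= i <= n)%nat -> 0 < t -> 0 < u ->
    Rabs (v i t - v i u) <= B * Rabs (t - u).
Proof.
  assert (Hb : 0 <= b) by (pose proof (P_range 0); lra).
  destruct (accel_regular b Hb f_C1) as [_ [B [_ [HB [_ [Hbd _]]]]]].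
  exists B. split; auto. intros i t u Hi Ht Hu.
  assert (Hpos : forall x, Rmin u t <= x -> 0 < x).
  { intros x Hx. pose proof (Rmin_glb_lt u t 0 Hu Ht). lra. }
  apply (bounded_derive_lipschitz _
    (fun x => accel (chain n P (fun j => s j x) i - chain n P (fun j => s j x) (S i))
                    (v i x))).
  - intros x [Hx _]. apply Hpos in Hx.
    apply (traj_v _ _ _ _ _ (sv_trajectory (x + 1))); auto. lra.
  - intros x [Hx _]. apply Hpos in Hx. apply Hbd; [apply chain_diff_range|].
    apply v_range; auto. lra.
Qed.

Lemma chain_along_lipschitz (i : nat) (t u : R) : 0 < t -> 0 < u ->
  Rabs (chain n P (fun j => s j t) i - chain n P (fun j => s j u) i)
    <= KP * vmax * Rabs (t - u).
Proof.
  intros Ht Hu. rewrite Rmult_assoc.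
  assert (0 <= vmax * Rabs (t - u)) by (apply Rmult_le_pos; [lra | apply Rabs_pos]).
  apply chain_lipschitz; [nra|].
  intros j Hj. eapply Rle_trans; [apply P_lipschitz|].
  apply Rmult_le_compat_l; [lra|].
  assert (Hpos : forall x, Rmin u t <= x -> 0 < x).
  { intros x Hx. pose proof (Rmin_glb_lt u t 0 Hu Ht). lra. }
  apply (bounded_derive_lipschitz _ (fun x => v (j - 1)%nat x - v j x)).
  - intros x [Hx _]. apply Hpos in Hx.
    apply (traj_s _ _ _ _ _ (sv_trajectory (x + 1))); auto. lra.
  - intros x [Hx _]. apply Hpos in Hx.
    destruct (v_range (j - 1)%nat x); [lia | lra |].
    destruct (v_range j x); [lia | lra |]. apply Rabs_le. lra.
Qed.

Lemma velocity_lim (i : nat) : (1 <= i <= n)%nat -> is_lim (v i) p_infty vstar.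
Proof.
  intros Hi.
  pose (E := fun t => energy U (fun i => s i t) (fun i => v i t)).
  assert (DE : forall t, 0 < t -> is_derive E t
    (- dissipation P (fun i => s i t) (fun i => v i t))).
  { intros t Ht. apply (energy_derive P U (t + 1)); auto. lra. }
  destruct (nonincreasing_is_lim E 0) as [l Hl].
  { intros x y Hxy.
    apply (energy_nonincreasing P U (y + 1) x y); auto; [lia | lra]. }
  { intros t _. unfold E. eapply Rle_trans; [|apply (energy_ge_term U _ _ i); auto].
    apply chain_ge; auto. lra. }
  destruct velocity_lipschitz as [B [HB Hlip]].
  apply is_lim_p_infty. intros eps Heps.
  (* Only the term of car [i] serves as [q], so that no regularity of the whole dissipation is
     needed. Its Lipschitz constant comes from factoring a difference of squares, where the sum of
     the two deviations is at most [2 * vmax] in absolute value. *)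
  destruct (barbalat (fun t => - E t)
    (fun t => dissipation P (fun i => s i t) (fun i => v i t))
    (fun t => mu * (v i t - vstar) ^ 2) (fun _ => 0) (mu * (2 * vmax * B)) (- l))
    with (eps := mu * eps ^ 2) as [M HM].
  - apply Rmult_lt_0_compat; nra.
  - intros t Ht.
    replace (dissipation P (fun i => s i t) (fun i => v i t)) with
      (opp (- dissipation P (fun i => s i t) (fun i => v i t)))
      by (unfold opp; simpl; ring).
    now apply (is_derive_opp E), DE.
  - intros t Ht. rewrite Rplus_0_r.
    now apply (dissipation_ge_term P (fun i => s i t) (fun i => v i t)).
  - intros t u Ht Hu.
    replace (mu * (v i t - vstar) ^ 2 - mu * (v i u - vstar) ^ 2) with
      (mu * (((v i t - vstar) + (v i u - vstar)) * (v i t - v i u))) by ring.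
    rewrite Rabs_mult, (Rabs_pos_eq mu), Rmult_assoc by lra.
    apply Rmult_le_compat_l; [lra|]. rewrite Rabs_mult, Rmult_assoc.
    apply Rmult_le_compat; try apply Rabs_pos; [|now apply Hlip].
    destruct (v_range i t); [lia | lra |]. destruct (v_range i u); [lia | lra |].
    apply Rabs_le. lra.
  - apply (is_lim_opp E p_infty l Hl).
  - apply is_lim_const.
  - apply Rmult_lt_0_compat; [lra | now apply pow_lt].
  - exists M. intros t Ht. specialize (HM t Ht).
    apply Rmult_lt_reg_l in HM; [|lra].
    rewrite <- (Rabs_pos_eq eps) by lra. apply Rsqr_lt_abs_0.
    unfold Rsqr. simpl in HM. lra.
Qed.

(** The damping term [a] in the equation of [v i] tends to 0, because [mu + g] is bounded along
    bounded forces; this is the perturbation that [barbalat] allows. *)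
Lemma chain_diff_lim (i : nat) : (1 <= i <= n)%nat ->
  is_lim (fun t => chain n P (fun j => s j t) i - chain n P (fun j => s j t) (S i))
    p_infty 0.
Proof.
  intros Hi.
  assert (Hb : 0 <= b) by (pose proof (P_range 0); lra).
  destruct (accel_regular b Hb f_C1) as [_ [B [_ [HB [_ [_ HG]]]]]].
  set (X := fun t => chain n P (fun j => s j t) i - chain n P (fun j => s j t) (S i)).
  assert (HX : forall t, - b <= X t <= b) by (intros t; apply chain_diff_range).
  assert (Hv := velocity_lim i Hi).
  set (a := fun t => - (mu + g (X t)) * (v i t - vstar)).
  assert (Ha : is_lim a p_infty 0).
  { rewrite is_lim_p_infty in Hv |- *. intros eps Heps.
    destruct (Hv (eps / B)) as [M HM]; [now apply Rdiv_lt_0_compat|].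
    exists M. intros t Ht. specialize (HM t Ht).
    rewrite Rminus_0_r. unfold a. rewrite Rabs_mult, Rabs_Ropp.
    pose proof (ACC_g_ge0 (X t)). specialize (HG (X t) (HX t)).
    rewrite (Rabs_pos_eq (mu + g (X t))) by lra.
    apply (Rmult_lt_compat_l B) in HM; [|lra].
    replace (B * (eps / B)) with eps in HM by (field; lra).
    eapply Rle_lt_trans; [|exact HM].
    apply Rmult_le_compat_r; [apply Rabs_pos | exact HG]. }
  assert (Dv : forall t, 0 < t -> is_derive (v i) t (X t + a t)).
  { intros t Ht. rewrite Rplus_comm.
    apply (traj_v _ _ _ _ _ (sv_trajectory (t + 1))); auto. lra. }
  assert (HXl : forall t u, 0 < t -> 0 < u ->
    Rabs (X t - X u) <= 2 * KP * vmax * Rabs (t - u)).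
  { intros t u Ht Hu.
    assert (H1 := chain_along_lipschitz i t u Ht Hu).
    assert (H2 := chain_along_lipschitz (S i) t u Ht Hu).
    apply Rabs_le_between in H1. apply Rabs_le_between in H2.
    apply Rabs_le. unfold X. lra. }
  assert (HK : 0 < 2 * KP * vmax) by (apply Rmult_lt_0_compat; lra).
  apply is_lim_p_infty. intros eps Heps.
  (* [barbalat] bounds its function from above only, so it is applied to [X] and then to [- X]. *)
  destruct (barbalat (v i) (fun t => X t + a t) X a (2 * KP * vmax) vstar)
    with (eps := eps) as [M1 HM1]; auto.
  { intros t _. lra. }
  destruct (barbalat (fun t => - v i t) (fun t => - (X t + a t)) (fun t => - X t)
    (fun t => - a t) (2 * KP * vmax) (- vstar))
    with (eps := eps) as [M2 HM2]; auto.
  { intros t Ht. now apply (is_derive_opp (v i)), Dv. }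
  { intros t _. lra. }
  { intros t u Ht Hu. replace (- X t - - X u) with (- (X t - X u)) by ring.
    rewrite Rabs_Ropp. now apply HXl. }
  { apply (is_lim_opp (v i) p_infty vstar Hv). }
  { replace (Finite 0) with (Rbar_opp 0) by (simpl; now rewrite Ropp_0).
    apply (is_lim_opp a p_infty 0 Ha). }
  exists (Rmax M1 M2). intros t Ht. rewrite Rminus_0_r.
  assert (X t < eps) by (apply HM1; eapply Rle_lt_trans; [apply Rmax_l | exact Ht]).
  assert (- X t < eps) by (apply HM2; eapply Rle_lt_trans; [apply Rmax_r | exact Ht]).
  apply Rabs_def1; lra.
Qed.

Lemma force_lim (i : nat) : (2 <= i <= n)%nat ->
  is_lim (fun t => P (s i t)) p_infty 0.
Proof.
  intros Hi.
  assert (H : forall m, (m <= n)%nat ->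
    is_lim (fun t => chain n P (fun j => s j t) (S m)) p_infty 0).
  { induction m as [|m IH]; intros Hm.
    - apply (is_lim_ext (fun _ => 0)).
      + intros t. now rewrite chain_out by lia.
      + apply is_lim_const.
    - apply (is_lim_ext (fun t => chain n P (fun j => s j t) (S m)
        - (chain n P (fun j => s j t) (S m) - chain n P (fun j => s j t) (S (S m))))).
      { intros t. ring. }
      replace (Finite 0) with (Finite (0 - 0)) by (f_equal; ring).
      apply is_lim_minus'; [apply IH; lia | apply chain_diff_lim; lia]. }
  apply (is_lim_ext (fun t => chain n P (fun j => s j t) (S (i - 1)))).
  - intros t. replace (S (i - 1)) with i by lia. now apply chain_in.
  - apply H. lia.
Qed.

End Truncation.
End Platoon.

(** * The potential and its truncation *)

Section Potential.

Variables (L lambda : R) (V : R -> R).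
Hypothesis L_lambda : L < lambda.
Hypothesis V_potential : ACC_potential L lambda V.

Lemma potential_derive (x : R) : L < x -> is_derive V x (Derive V x).
Proof.
  intros Hx. apply Derive_correct, (potential_C2 _ _ _ V_potential x Hx).
Qed.

Lemma potential_derive2 (x : R) :
  L < x -> is_derive (Derive V) x (Derive_n V 2 x).
Proof.
  intros Hx. apply (Derive_correct (Derive V)).
  apply (potential_C2 _ _ _ V_potential x Hx).
Qed.

Lemma potential_derive_increasing (x y : R) :
  L < x <= y -> Derive V x <= Derive V y.
Proof.
  intros Hxy. enough (0 - 0 <= Derive V y - Derive V x) by lra.
  apply (derive_le_increment (fun _ => 0) (Derive V) (fun _ => 0) (Derive_n V 2)).
  - lra.
  - intros. apply continuity_pt_const. intros ? ?; auto.
  - intros t Ht. eapply is_derive_continuity_pt, potential_derive2. lra.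
  - intros. apply (is_derive_const 0).
  - intros t Ht. apply potential_derive2. lra.
  - intros t Ht. apply (potential_convex _ _ _ V_potential). lra.
Qed.

(* Points beyond [lambda], including [lambda], are minima of [V]. *)
Lemma potential_derive_eq0 (x : R) : lambda <= x -> Derive V x = 0.
Proof.
  intros Hx.
  assert (pr : derivable_pt V x).
  { apply ex_derive_Reals_0. exists (Derive V x). apply potential_derive. lra. }
  rewrite <- (Derive_Reals V x pr). apply (deriv_minimum V L (x + 1)); try lra.
  intros y Hy _. rewrite (potential_eq0 _ _ _ V_potential x Hx).
  now apply (potential_ge0 _ _ _ V_potential).
Qed.

Lemma potential_derive_le0 (x : R) : L < x -> Derive V x <= 0.
Proof.
  intros Hx. rewrite <- (potential_derive_eq0 (Rmax lambda x)) by apply Rmax_l.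
  apply potential_derive_increasing. split; auto. apply Rmax_r.
Qed.

Lemma potential_decreasing (x y : R) : L < x <= y -> V y <= V x.
Proof.
  intros Hxy. enough (V y - V x <= 0 - 0) by lra.
  apply (derive_le_increment V (fun _ => 0) (Derive V) (fun _ => 0)).
  - lra.
  - intros t Ht. eapply is_derive_continuity_pt, potential_derive. lra.
  - intros. apply continuity_pt_const. intros ? ?; auto.
  - intros t Ht. apply potential_derive. lra.
  - intros. apply (is_derive_const 0).
  - intros t Ht. apply potential_derive_le0. lra.
Qed.

(** For [x < lambda] the tangent at [x] lies below [V]. Read at [lambda], where [V] vanishes, this
    gives the bound with [lambda - x], which is less than [lambda - L]. *)
Lemma potential_le_derive (x : R) :
  L < x -> V x <= - Derive V x * (lambda - L).
Proof.
  intros Hx. pose proof (potential_derive_le0 x Hx).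
  destruct (Rle_lt_dec lambda x) as [Hl|Hl].
  - rewrite (potential_eq0 _ _ _ V_potential x Hl). nra.
  - assert (Derive V x * lambda - Derive V x * x <= V lambda - V x).
    { apply (derive_le_increment (fun t => Derive V x * t) V
        (fun _ => Derive V x) (Derive V)).
      - lra.
      - intros t _. apply (is_derive_continuity_pt _ _ (Derive V x)).
        auto_derive; auto; ring.
      - intros t Ht. eapply is_derive_continuity_pt, potential_derive. lra.
      - intros t _. auto_derive; auto; ring.
      - intros t Ht. apply potential_derive. lra.
      - intros t Ht. apply potential_derive_increasing. lra. }
    rewrite (potential_eq0 _ _ _ V_potential lambda) in H0 by lra. nra.
Qed.

Lemma potential_unbounded (E : R) : exists sigma, L < sigma /\ E < V sigma.
Proof.
  destruct (potential_lim _ _ _ V_potential (fun y => E < y)) as [d Hd].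
  { exists E. auto. }
  exists (L + d / 2). pose proof (cond_pos d). split; [lra|].
  apply Hd; [|lra]. change (Rabs (L + d / 2 - L) < d).
  rewrite Rabs_pos_eq; lra.
Qed.

Variable sigma : R.
Hypothesis sigma_range : L < sigma < lambda.

(** Below [sigma] the force keeps the value [Derive V sigma]. The clamp at [lambda] changes nothing,
    the force being 0 from there on, but it confines the argument to a compact segment, which yields
    a global Lipschitz constant. *)
Definition truncated_force (x : R) : R := Derive V (clamp sigma lambda x).

Lemma truncated_force_eq (x : R) :
  sigma <= x -> truncated_force x = Derive V x.
Proof.
  intros Hx. unfold truncated_force. destruct (Rle_lt_dec lambda x).
  - rewrite clamp_above, !potential_derive_eq0; lra.
  - rewrite clamp_id; lra.
Qed.

(** The double negation matches the hypothesis [- b <= P x] for [b = - Derive V sigma]. *)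
Lemma truncated_force_range (x : R) :
  - - Derive V sigma <= truncated_force x <= 0.
Proof.
  rewrite Ropp_involutive. unfold truncated_force.
  destruct (clamp_range sigma lambda x); [lra|]. split.
  - apply potential_derive_increasing. lra.
  - apply potential_derive_le0. lra.
Qed.

Lemma truncated_force_lipschitz :
  exists K, 0 < K /\ forall x y,
    Rabs (truncated_force x - truncated_force y) <= K * Rabs (x - y).
Proof.
  destruct (C1_lipschitz_segment (Derive V) (Derive_n V 2) sigma lambda)
    as [K [HK Hlip]].
  - lra.
  - intros x Hx. apply potential_derive2. lra.
  - intros x Hx. apply continuity_pt_filterlim.
    apply (potential_C2 _ _ _ V_potential x). lra.
  - exists K. split; auto. intros x y. unfold truncated_force.
    eapply Rle_trans; [apply Hlip; apply clamp_range; lra|].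
    apply Rmult_le_compat_l; [lra | apply clamp_lipschitz].
Qed.

(** [U] is the primitive of the truncated force that takes the value [V sigma] at [sigma]. Its last
    property is the energy barrier: a spacing that reached [sigma] would cost at least [V sigma]. *)
Lemma truncated_potential_exists :
  exists U : R -> R,
    (forall x, is_derive U x (truncated_force x)) /\ (forall x, 0 <= U x) /\
    (forall x, sigma <= x -> U x = V x) /\ (forall x, x <= sigma -> V sigma <= U x).
Proof.
  destruct truncated_force_lipschitz as [K [HK Hlip]].
  assert (cP : forall x, continuous truncated_force x).
  { intros x. apply continuity_pt_filterlim.
    apply (lipschitz_continuity_pt _ K). auto. }
  pose (U := fun x => V sigma + RInt truncated_force sigma x).
  assert (DU : forall x, is_derive U x (truncated_force x)).
  { intros x. unfold U. rewrite <- (Rplus_0_l (truncated_force x)).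
    apply (is_derive_plus (fun _ => V sigma) (fun x => RInt truncated_force sigma x)).
    - apply (is_derive_const (V sigma)).
    - apply (is_derive_RInt truncated_force _ sigma); auto.
      apply filter_forall. intros y. apply (RInt_correct (V := R_CompleteNormedModule)).
      apply (ex_RInt_continuous (V := R_CompleteNormedModule)). auto. }
  assert (Us : U sigma = V sigma) by (unfold U; rewrite RInt_point; apply Rplus_0_r).
  assert (Hr : forall x, sigma <= x -> U x = V x).
  { intros x Hx.
    assert (forall t, sigma <= t <= x -> is_derive V t (truncated_force t)).
    { intros t Ht. rewrite truncated_force_eq by lra. apply potential_derive. lra. }
    assert (forall t, sigma <= t <= x -> continuity_pt V t).
    { intros t Ht. eapply is_derive_continuity_pt, H, Ht. }
    assert (forall t, continuity_pt U t).
    { intros t. eapply is_derive_continuity_pt, DU. }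
    assert (forall t, sigma < t < x -> is_derive V t (truncated_force t)).
    { intros t Ht. apply H. lra. }
    assert (forall t, sigma < t < x -> truncated_force t <= truncated_force t).
    { intros. apply Rle_refl. }
    enough (U x - U sigma <= V x - V sigma /\ V x - V sigma <= U x - U sigma) by lra.
    split; apply (derive_le_increment _ _ truncated_force truncated_force); auto. }
  assert (Hd : forall x, x <= sigma -> V sigma <= U x).
  { intros x Hx. enough (U sigma - U x <= 0 - 0) by lra.
    apply (derive_le_increment U (fun _ => 0) truncated_force (fun _ => 0)); auto.
    - intros t _. eapply is_derive_continuity_pt, DU.
    - intros. apply continuity_pt_const. intros ? ?; auto.
    - intros. apply (is_derive_const 0).
    - intros t _. apply truncated_force_range. }
  exists U. split; [auto|split; [|auto]].
  intros x. assert (HV := potential_ge0 _ _ _ V_potential).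
  destruct (Rle_lt_dec sigma x) as [H|H].
  - rewrite Hr by auto. apply HV. lra.
  - apply Rle_trans with (V sigma); [apply HV; lra | apply Hd; lra].
Qed.

End Potential.

(** * Relative derivatives and solutions of the model *)

Lemma is_derive_D_in (x d : R -> R) (J : R -> Prop) (t : R) :
  is_derive x t (d t) -> D_in x d J t.
Proof.
  intros H. apply is_derive_Reals in H. intros eps Heps.
  destruct (H eps Heps) as [delta Hdelta].
  exists delta. split; [apply cond_pos|].
  intros u [[_ Hne] Hu]. simpl in *. unfold Rdist in *.
  replace (x u) with (x (t + (u - t))) by (f_equal; ring).
  apply Hdelta; auto. lra.
Qed.

Lemma D_in_is_derive (x d : R -> R) (T t : R) :
  0 < t < T -> D_in x d (fun t => 0 <= t < T) t -> is_derive x t (d t).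
Proof.
  intros Ht H. apply is_derive_Reals. intros eps Heps.
  destruct (H eps Heps) as [delta [Hdelta Hd]].
  assert (Hm : 0 < Rmin delta (Rmin t (T - t)))
    by (repeat apply Rmin_glb_lt; lra).
  exists (mkposreal _ Hm). intros h Hh Hlt. simpl in *. unfold Rdist in *.
  assert (Rabs h < delta /\ Rabs h < t /\ Rabs h < T - t) as [H1 [H2 H3]].
  { repeat split; (eapply Rlt_le_trans; [exact Hlt|]).
    - apply Rmin_l.
    - eapply Rle_trans; [apply Rmin_r | apply Rmin_l].
    - eapply Rle_trans; [apply Rmin_r | apply Rmin_r]. }
  apply Rabs_def2 in H2. apply Rabs_def2 in H3.
  specialize (Hd (t + h)). replace (t + h - t) with h in Hd by ring.
  apply Hd. repeat split; auto; lra.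
Qed.

(* A solution on [[0, T)] is only one-sided at 0; frozen at negative times it
   becomes continuous there. *)
Lemma D_in_frozen_continuity_pt (x d : R -> R) (T t : R) :
  0 <= t < T -> D_in x d (fun t => 0 <= t < T) t ->
  continuity_pt (fun u => x (Rmax 0 u)) t.
Proof.
  intros Ht H. apply cont_deriv in H. intros eps Heps.
  destruct (H eps Heps) as [delta [Hdelta Hd]].
  assert (Hm : 0 < Rmin delta (T - t)) by (apply Rmin_glb_lt; lra).
  exists (Rmin delta (T - t)). split; auto. intros u [_ Hu].
  simpl in *. unfold Rdist in *. rewrite (Rmax_right 0 t) by lra.
  destruct (Req_dec (Rmax 0 u) t) as [->|Hne].
  { now rewrite Rminus_diag, Rabs_R0. }
  assert (Rabs (u - t) < delta /\ Rabs (u - t) < T - t) as [H1 H2].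
  { split; (eapply Rlt_le_trans; [exact Hu|]); [apply Rmin_l | apply Rmin_r]. }
  apply Rabs_def2 in H1. apply Rabs_def2 in H2.
  apply Hd. unfold Rmax in *. destruct (Rle_dec 0 u).
  - repeat split; auto; try lra. apply Rabs_def1; lra.
  - repeat split; auto; try lra. apply Rabs_def1; lra.
Qed.

Lemma is_derive_frozen (x : R -> R) (t l : R) :
  0 < t -> is_derive x t l -> is_derive (fun u => x (Rmax 0 u)) t l.
Proof.
  intros Ht. apply is_derive_ext_loc.
  exists (mkposreal t Ht). intros u Hu. change (Rabs (u - t) < t) in Hu.
  apply Rabs_def2 in Hu. now rewrite Rmax_right by lra.
Qed.

Section Solutions.

Variables (n : nat) (mu L vmax vstar : R) (V f : R -> R).
Hypothesis n_ge2 : (2 <= n)%nat.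

Let p (s : nat -> R -> R) (i : nat) (t : R) : R :=
  chain n (Derive V) (fun j => s j t) i.

Lemma accel_first (s : nat -> R -> R) (t c : R) :
  accel mu vmax vstar f (p s 1 t - p s 2 t) c
  = - ACC_k_first mu vmax vstar V f (s 2%nat t) * (c - vstar) - Derive V (s 2%nat t).
Proof.
  unfold p, accel, ACC_k_first.
  rewrite chain_out, chain_in, Rminus_0_l by lia. ring.
Qed.

Lemma accel_mid (s : nat -> R -> R) (i : nat) (t c : R) :
  (2 <= i <= n - 1)%nat ->
  accel mu vmax vstar f (p s i t - p s (S i) t) c
  = - ACC_k_mid mu vmax vstar V f (s i t) (s (i + 1)%nat t) * (c - vstar)
    + Derive V (s i t) - Derive V (s (i + 1)%nat t).
Proof.
  intros Hi. unfold p, accel, ACC_k_mid.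
  rewrite !chain_in by lia. replace (i + 1)%nat with (S i) by lia. ring.
Qed.

Lemma accel_last (s : nat -> R -> R) (t c : R) :
  accel mu vmax vstar f (p s n t - p s (S n) t) c
  = - ACC_k_last mu vmax vstar V f (s n t) * (c - vstar) + Derive V (s n t).
Proof.
  unfold p, accel, ACC_k_last.
  rewrite chain_in, chain_out, Rminus_0_r by lia. reflexivity.
Qed.

Lemma ACC_solution_intro (J : R -> Prop) (s v : nat -> R -> R) :
  (forall t i, J t -> (2 <= i <= n)%nat -> L < s i t) ->
  (forall t i, J t -> (2 <= i <= n)%nat ->
     is_derive (s i) t (v (i - 1)%nat t - v i t)) ->
  (forall t i, J t -> (1 <= i <= n)%nat ->
     is_derive (v i) t (accel mu vmax vstar f (p s i t - p s (S i) t) (v i t))) ->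
  ACC_solution n mu L vmax vstar V f J s v.
Proof.
  intros Hs Ds Dv. constructor; auto.
  - intros t i Ht Hi. now apply is_derive_D_in, Ds.
  - intros t Ht. apply is_derive_D_in. rewrite <- accel_first.
    apply Dv; auto; lia.
  - intros t i Ht Hi. apply is_derive_D_in. rewrite <- accel_mid by auto.
    apply Dv; auto; lia.
  - intros t Ht. apply is_derive_D_in. rewrite <- accel_last.
    apply Dv; auto; lia.
Qed.

Lemma ACC_solution_v (J : R -> Prop) (s v : nat -> R -> R) :
  ACC_solution n mu L vmax vstar V f J s v ->
  forall t i, J t -> (1 <= i <= n)%nat ->
  D_in (v i) (fun u => accel mu vmax vstar f (p s i u - p s (S i) u) (v i u)) J t.
Proof.
  intros [_ _ H1 Hm Hn] t i Ht Hi. unfold D_in in *.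
  destruct (Nat.eq_dec i 1) as [->|Hi1]; [|destruct (Nat.eq_dec i n) as [->|Hin]].
  - rewrite accel_first. now apply H1.
  - rewrite accel_last. now apply Hn.
  - rewrite accel_mid by lia. apply Hm; auto; lia.
Qed.

Lemma ACC_solution_trajectory (T : R) (s v : nat -> R -> R) :
  ACC_solution n mu L vmax vstar V f (fun t => 0 <= t < T) s v ->
  trajectory n mu vmax vstar f (Derive V) (fun c => c) T
    (fun i t => s i (Rmax 0 t)) (fun i t => v i (Rmax 0 t)).
Proof.
  intros HS. constructor.
  - intros i t Hi Ht. eapply D_in_frozen_continuity_pt; [exact Ht|].
    now apply (ACC_s _ _ _ _ _ _ _ _ _ _ HS).
  - intros i t Hi Ht. eapply D_in_frozen_continuity_pt; [exact Ht|].
    apply (ACC_solution_v _ _ _ HS); auto.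
  - intros i t Hi Ht. rewrite !Rmax_right by lra.
    apply is_derive_frozen; [lra|].
    apply (D_in_is_derive (s i) (fun u => v (i - 1)%nat u - v i u) T); auto.
    apply (ACC_s _ _ _ _ _ _ _ _ _ _ HS); auto; lra.
  - intros i t Hi Ht. rewrite !Rmax_right by lra.
    apply is_derive_frozen; [lra|].
    apply (D_in_is_derive (v i)
      (fun u => accel mu vmax vstar f (p s i u - p s (S i) u) (v i u)) T); auto.
    apply (ACC_solution_v _ _ _ HS); auto; lra.
Qed.

End Solutions.

(** * Removal of the truncations and comparison with an arbitrary solution *)

Theorem theorem2p1 (n : nat) (mu lambda L vmax vstar : R) (V f : R -> R)
  (hn : (2 <= n)%nat)
  (hmu : 0 < mu)
  (hL : 0 < L) (hlambda : L < lambda)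
  (hvstar : 0 < vstar) (hvmax : vstar < vmax)
  (hV : ACC_potential L lambda V)
  (hf : class_C1 f)
  (hfmono : forall x y, x <= y -> f x <= f y)
  (hfge : forall x, Rmax x 0 <= f x)
  (s0 v0 : nat -> R)
  (h0 : ACC_Omega n L vmax s0 v0) :
  exists s v : nat -> R -> R,
    ACC_starts_at n s0 v0 s v /\
    ACC_solution n mu L vmax vstar V f (fun t => 0 <= t) s v /\
    (forall (T : R) (s' v' : nat -> R -> R),
       ACC_starts_at n s0 v0 s' v' ->
       ACC_solution n mu L vmax vstar V f (fun t => 0 <= t < T) s' v' ->
       forall t, 0 <= t < T ->
         (forall i, (2 <= i <= n)%nat -> s' i t = s i t) /\
         (forall i, (1 <= i <= n)%nat -> v' i t = v i t)) /\
    (forall t, 0 <= t -> ACC_Omega n L vmax (fun i => s i t) (fun i => v i t)) /\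
    (forall t i, 0 <= t -> (2 <= i <= n)%nat ->
       s i t <= Rmax lambda (s i 0) + / mu * vmax) /\
    (forall i, (1 <= i <= n)%nat -> is_lim (v i) p_infty vstar) /\
    (forall i, (2 <= i <= n)%nat -> is_lim (fun t => V (s i t)) p_infty 0).
Proof.
  destruct h0 as [Hs0 [Hv0 Hv0']].
  set (E0 := energy n vstar V s0 v0).
  assert (HV0 := potential_ge0 _ _ _ hV).
  assert (HE0 : forall i, (2 <= i <= n)%nat -> V (s0 i) <= E0).
  { intros i Hi. rewrite <- (chain_in n V s0 i Hi).
    apply energy_ge_term; [|lia]. intros j Hj. now apply HV0, Hs0. }
  destruct (potential_unbounded _ _ _ hV E0) as [sigma [HLs HEs]].
  (* [V] vanishes from [lambda] on, whereas [V sigma] exceeds [E0], which dominates the nonnegative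
     potential of the gap 2. *)
  assert (Hsl : sigma < lambda).
  { apply Rnot_le_lt. intros H.
    rewrite (potential_eq0 _ _ _ hV sigma H) in HEs.
    pose proof (HE0 2%nat ltac:(lia)).
    pose proof (HV0 (s0 2%nat) (Hs0 2%nat ltac:(lia))). lra. }
  assert (Hsig : L < sigma < lambda) by lra.
  set (P := truncated_force lambda V sigma).
  assert (HPr := truncated_force_range _ _ _ hlambda hV sigma Hsig). fold P in HPr.
  assert (HPe := truncated_force_eq _ _ _ hlambda hV sigma Hsig). fold P in HPe.
  destruct (truncated_force_lipschitz _ _ _ hV sigma Hsig) as [KP [HKP HPl]].
  fold P in HPl.
  destruct (truncated_potential_exists _ _ _ hlambda hV sigma Hsig)
    as [U [DU [HU0 [HUe HUs]]]]. fold P in DU.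
  assert (Hcl : forall c, 0 <= c <= vmax -> clamp 0 vmax c = c)
    by (intros; now apply clamp_id).
  destruct (truncated_flow_exists n mu vmax vstar f hmu hvstar hvmax hfge P
    (- Derive V sigma) KP hf HKP HPr HPl s0 v0) as [s [v [Hs [Hv [Ds Dv]]]]].
  assert (HTc : forall T, trajectory n mu vmax vstar f P (clamp 0 vmax) T s v).
  { intros T. constructor.
    - intros i t Hi Ht. eapply is_derive_continuity_pt, Ds; auto; lra.
    - intros i t Hi Ht. eapply is_derive_continuity_pt, Dv; auto; lra.
    - intros i t Hi Ht. apply Ds; auto; lra.
    - intros i t Hi Ht. apply Dv; auto; lra. }
  (* Velocities come before spacings: this bound makes the clamp inactive, and only then does the
     energy balance apply. *)
  assert (Hvr : forall i t, (1 <= i <= n)%nat -> 0 <= t -> 0 <= v i t <= vmax).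
  { intros i t Hi Ht.
    apply (velocity_range n mu vmax vstar f hmu hvstar hvmax hfge P (clamp 0 vmax)
      (t + 1) s v); auto; try lra.
    - intros c Hc. rewrite clamp_above; lra.
    - intros c Hc. rewrite clamp_below; lra.
    - intros j Hj. rewrite Hv. auto. }
  assert (HT : forall T, trajectory n mu vmax vstar f P (fun c => c) T s v).
  { intros T. apply (trajectory_congr n mu vmax vstar f P P (clamp 0 vmax)); auto.
    intros i t Hi Ht. apply Hcl, Hvr; auto. lra. }
  assert (HE : forall t, 0 <= t ->
    energy n vstar U (fun i => s i t) (fun i => v i t) <= E0).
  { intros t Ht.
    replace E0 with (energy n vstar U (fun i => s i 0) (fun i => v i 0)).
    - apply (energy_nonincreasing n mu vmax vstar f hmu hvstar hvmax hfge P U (t + 1));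
        auto; try lra; lia.
    - apply energy_ext; auto. intros i Hi. rewrite Hs.
      (* [U] and [V] agree at the initial spacings: one below [sigma] would have potential at least
         [V sigma], hence above [E0]. *)
      apply HUe, Rnot_lt_le. intros Hlt.
      pose proof (potential_decreasing _ _ _ hlambda hV (s0 i) sigma
        ltac:(split; [now apply Hs0 | lra])).
      specialize (HE0 i Hi). lra. }
  assert (Hsg : forall i t, (2 <= i <= n)%nat -> 0 <= t -> sigma < s i t).
  { intros i t Hi Ht. apply Rnot_le_lt. intros Hle. specialize (HE t Ht).
    assert (H := energy_ge_term n vstar U (fun i => s i t) (fun i => v i t) i
      ltac:(auto) ltac:(lia)).
    rewrite chain_in in H by auto. specialize (HUs _ Hle). lra. }
  assert (HPs : forall i t, (2 <= i <= n)%nat -> 0 <= t -> P (s i t) = Derive V (s i t)).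
  { intros i t Hi Ht. apply HPe, Rlt_le, Hsg; auto. }
  exists s, v. split; [|split; [|split; [|split; [|split; [|split]]]]].
  - split; auto.
  - apply ACC_solution_intro; auto.
    + intros t i Ht Hi. specialize (Hsg i t Hi Ht). lra.
    + intros t i Ht Hi. rewrite <- (Hcl (v i t)), <- (Hcl (v (i - 1)%nat t))
        by (apply Hvr; auto; lia). now apply Ds.
    + intros t i Ht Hi. rewrite <- (Hcl (v i t)) by (now apply Hvr).
      rewrite <- !(chain_ext n P (Derive V)) by auto. now apply Dv.
  (* For another solution the energy is taken with [V] itself, its spacings being above [L] by
     [ACC_domain]. This puts them above [sigma], so the solution also solves the truncated system,
     where uniqueness is known. *)
  - intros T s' v' [Hs' Hv'] HS'.
    assert (Hdom := ACC_domain _ _ _ _ _ _ _ _ _ _ HS').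
    assert (HTd := ACC_solution_trajectory _ _ _ _ _ _ _ hn _ _ _ HS').
    set (sf := fun (i : nat) (t : R) => s' i (Rmax 0 t)) in HTd.
    set (vf := fun (i : nat) (t : R) => v' i (Rmax 0 t)) in HTd.
    assert (Hsf0 : forall i, sf i 0 = s' i 0)
      by (intros i; unfold sf; now rewrite Rmax_left by lra).
    assert (Hvf0 : forall i, vf i 0 = v' i 0)
      by (intros i; unfold vf; now rewrite Rmax_left by lra).
    assert (Hsfd : forall i t, (2 <= i <= n)%nat -> 0 <= t < T -> L < sf i t).
    { intros i t Hi Ht. unfold sf. rewrite Rmax_right by lra. now apply Hdom. }
    assert (Hvfr : forall i t, (1 <= i <= n)%nat -> 0 <= t < T -> 0 <= vf i t <= vmax).
    { apply (velocity_range n mu vmax vstar f hmu hvstar hvmax hfge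
        (Derive V) (fun c => c) T sf vf); auto.
      intros j Hj. rewrite Hvf0, Hv' by auto. auto. }
    assert (Hsfg : forall i t, (2 <= i <= n)%nat -> 0 <= t < T -> sigma < sf i t).
    { intros i t Hi Ht. apply Rnot_le_lt. intros Hle.
      assert (energy n vstar V (fun i => sf i t) (fun i => vf i t) <= E0).
      { replace E0 with (energy n vstar V (fun i => sf i 0) (fun i => vf i 0)).
        - apply (energy_nonincreasing n mu vmax vstar f hmu hvstar hvmax hfge
            (Derive V) V T); auto; try lra; [lia|].
          intros j u Hj Hu. apply (potential_derive L lambda); auto.
        - apply energy_ext; intros j Hj.
          + rewrite Hsf0, Hs' by auto. reflexivity.
          + rewrite Hvf0, Hv' by auto. reflexivity. }
      assert (H1 := energy_ge_term n vstar V (fun i => sf i t) (fun i => vf i t) i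
        ltac:(auto) ltac:(lia)).
      rewrite chain_in in H1 by auto.
      pose proof (potential_decreasing _ _ _ hlambda hV (sf i t) sigma
        ltac:(split; [now apply Hsfd | lra])). lra. }
    intros t Ht.
    destruct (trajectory_unique n mu vmax vstar f hmu hvstar hvmax hfge P
      (- Derive V sigma) KP hf HKP HPr HPl T sf vf s v) with (t := t) as [H1 H2]; auto.
    + apply (trajectory_congr n mu vmax vstar f (Derive V) P (fun c => c)); auto.
      * intros i u Hi Hu. symmetry. apply HPe, Rlt_le, Hsfg; auto. lra.
      * intros i u Hi Hu. symmetry. apply Hcl, Hvfr; auto. lra.
    + intros i Hi. rewrite Hsf0, Hs', Hs; auto.
    + intros i Hi. rewrite Hvf0, Hv', Hv; auto.
    + split; intros i Hi; [rewrite <- H1 by auto | rewrite <- H2 by auto];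
        unfold sf, vf; now rewrite Rmax_right by lra.
  - intros t Ht. split; [|split]; intros i Hi.
    + specialize (Hsg i t Hi Ht). lra.
    + now apply Hvr.
    + now apply Hvr.
  - intros t i Ht Hi.
    apply (spacing_bound n mu vmax vstar f hmu hvstar hvmax hfge P lambda (t + 1) t s v);
      auto; try lra.
    + intros j u Hj Hu. apply Hvr; auto; lra.
    + intros j u _ _. apply HPr.
    + intros x Hx. rewrite HPe by lra.
      now apply (potential_derive_eq0 L lambda).
  - intros i Hi.
    now apply (velocity_lim n mu vmax vstar f hmu hvstar hvmax hfge P
      (- Derive V sigma) hf HPr U s v).
  - intros i Hi.
    assert (HF := force_lim n mu vmax vstar f hmu hvstar hvmax hfge P
      (- Derive V sigma) KP hf HKP HPr HPl U s v HT Hvr DU HU0 i Hi).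
    rewrite is_lim_p_infty in HF |- *. intros eps Heps.
    (* The divisor is the factor lost in [potential_le_derive]. *)
    destruct (HF (eps / (lambda - L))) as [M HM]; [apply Rdiv_lt_0_compat; lra|].
    exists (Rmax 0 M). intros t Ht.
    pose proof (Rmax_l 0 M). pose proof (Rmax_r 0 M).
    specialize (HM t ltac:(lra)). specialize (Hsg i t Hi ltac:(lra)).
    rewrite Rminus_0_r in *. rewrite HPs in HM by (auto; lra).
    apply Rabs_def2 in HM.
    assert (H1 := potential_le_derive _ _ _ hlambda hV (s i t) ltac:(lra)).
    specialize (HV0 (s i t) ltac:(lra)). rewrite Rabs_pos_eq by auto.
    eapply Rle_lt_trans; [exact H1|].
    replace eps with (eps / (lambda - L) * (lambda - L)) by (field; lra).
    apply Rmult_lt_compat_r; lra.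
Qed.
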